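(* Let $\mathcal{A}\in\mathbb{K}_l^{m\times r}$, $\mathcal{B}\in\mathbb{K}_l^{s\times n}$, $\mathcal{C}\in\mathbb{K}_l^{m\times n}$, let $\mathcal{M}\in\mathbb{K}_l^{r\times r}$ and $\mathcal{N}\in\mathbb{K}_l^{s\times s}$ be T-symmetric T-positive definite, and let $\mathfrak{D}_{\mathcal{S}}$, $\mathfrak{D}_{\mathcal{V}}$ be fixed probability distributions over random tubal matrices in $\mathbb{K}_l^{m\times\tau}$ and $\mathbb{K}_l^{n\times\zeta}$, respectively. For independent $\mathcal{S}\sim\mathfrak{D}_{\mathcal{S}}$, $\mathcal{V}\sim\mathfrak{D}_{\mathcal{V}}$ put $$\mathcal{E}=\mathcal{S}*(\mathcal{S}^{T}*\mathcal{A}*\mathcal{M}^{-1}*\mathcal{A}^{T}*\mathcal{S})^{\dag}*\mathcal{S}^{T},\qquad \mathcal{G}=\mathcal{V}*(\mathcal{V}^{T}*\mathcal{B}^{T}*\mathcal{N}^{-1}*\mathcal{B}*\mathcal{V})^{\dag}*\mathcal{V}^{T},$$ $$\mathcal{Z}=\mathcal{M}^{-\frac12}*\mathcal{A}^{T}*\mathcal{E}*\mathcal{A}*\mathcal{M}^{-\frac12},\qquad \mathcal{W}=\mathcal{N}^{-\frac12}*\mathcal{B}*\mathcal{G}*\mathcal{B}^{T}*\mathcal{N}^{-\frac12}.$$ Assume that $\mathbb{E}[\mathcal{Z}]$ and $\mathbb{E}[\mathcal{W}]$ are T-symmetric T-positive definite, and let $\mathcal{X}^{\star}\in\mathbb{K}_l^{r\times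 s}$ satisfy $\mathcal{A}*\mathcal{X}^{\star}*\mathcal{B}=\mathcal{C}$. Let $\{\mathcal{X}^{t}\}_{t\ge 0}$ be the TESP iteration started at $\mathcal{X}^{0}\in\mathbb{K}_l^{r\times s}$: at each step $t$ one draws fresh, independent $\mathcal{S}\sim\mathfrak{D}_{\mathcal{S}}$ and $\mathcal{V}\sim\mathfrak{D}_{\mathcal{V}}$ (independent also of the past), forms from these draws $\mathcal{E}=\mathcal{S}*(\mathcal{S}^{T}*\mathcal{A}*\mathcal{M}^{-1}*\mathcal{A}^{T}*\mathcal{S})^{\dag}*\mathcal{S}^{T}$ and $\mathcal{G}=\mathcal{V}*(\mathcal{V}^{T}*\mathcal{B}^{T}*\mathcal{N}^{-1}*\mathcal{B}*\mathcal{V})^{\dag}*\mathcal{V}^{T}$, and sets $$\mathcal{X}^{t+1}=\mathcal{X}^{t}-\mathcal{M}^{-1}*\mathcal{A}^{T}*\mathcal{E}*(\mathcal{A}*\mathcal{X}^{t}*\mathcal{B}-\mathcal{C})*\mathcal{G}*\mathcal{B}^{T}*\mathcal{N}^{-1}.$$ Then for all $t\ge 0$ $$\mathbb{E}\left[\|\mathcal{X}^{t}-\mathcal{X}^{\star}\|_{F(\mathcal{M},\mathcal{N})}^{2}\mid\mathcal{X}^{0}\right]\le \rho_{\text{TESP}}^{\,t}\,\|\mathcal{X}^{0}-\mathcal{X}^{\star}\|_{F(\mathcal{M},\mathcal{N})}^{2},\qquad \rho_{\text{TESP}}=1-\lambda_{\min}\big(\mathbb{E}[\mathrm{bcirc}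(\mathcal{W}\otimes_{t}\mathcal{Z})]\big).$$
   Context: Fix $l\ge 1$. $\mathbb{K}_l^{m\times n}=\mathbb{R}^{m\times n\times l}$ (tubal matrices), $\mathbb{K}_l^{m}=\mathbb{K}_l^{m\times 1}$. $\mathcal{A}_{(k)}$ is the $k$-th frontal slice $\mathcal{A}(:,:,k)$. $\mathrm{unfold}(\mathcal{A})$ is the block column with blocks $\mathcal{A}_{(1)},\dots,\mathcal{A}_{(l)}$, $\mathrm{fold}$ is its inverse, and $\mathrm{bcirc}(\mathcal{A})$ is the block circulant matrix whose first block column is $\mathrm{unfold}(\mathcal{A})$ (block $(p,q)$ is $\mathcal{A}_{(((p-q)\bmod l)+1)}$). The t-product is $\mathcal{A}*\mathcal{B}=\mathrm{fold}(\mathrm{bcirc}(\mathcal{A})\,\mathrm{unfold}(\mathcal{B}))$. The identity $\mathcal{I}_n$ has first frontal slice the identity matrix and other slices zero; $\mathcal{A}^{-1}$ is the two-sided inverse with respect to $*$. The transpose: $(\mathcal{A}^{T})_{(1)}=\mathcal{A}_{(1)}^{T}$, $(\mathcal{A}^{T})_{(k)}=\mathcal{A}_{(l-k+2)}^{T}$ for $k=2,\dots,l$. The slice transpose: $(\mathcal{A}^{ST})_{(k)}=\mathcal{A}_{(k)}^{T}$ for all $k$. $\mathcal{A}^{\dag}$ is the unique Moore–Penrose inverse, i.e. the unique $\mathcal{Y}$ with $\mathcal{A}*\mathcal{Y}*\mathcal{A}=\mathcal{A}$, $\mathcal{Y}*\mathcal{A}*\mathcal{Y}=\mathcal{Y}$,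 $(\mathcal{A}*\mathcal{Y})^{T}=\mathcal{A}*\mathcal{Y}$, $(\mathcal{Y}*\mathcal{A})^{T}=\mathcal{Y}*\mathcal{A}$. $\langle\cdot,\cdot\rangle$ is the entrywise (Frobenius) inner product. $\mathcal{M}$ is T-symmetric if $\mathcal{M}=\mathcal{M}^{T}$, and T-symmetric T-positive definite if moreover $\langle\overrightarrow{\mathcal{X}},\mathcal{M}*\overrightarrow{\mathcal{X}}\rangle>0$ for all nonzero $\overrightarrow{\mathcal{X}}\in\mathbb{K}_l^{n}$. Its square root $\mathcal{M}^{\frac12}$ is defined by $\mathrm{bcirc}(\mathcal{M}^{\frac12})=\mathrm{bcirc}(\mathcal{M})^{\frac12}$, and $\mathcal{M}^{-\frac12}=(\mathcal{M}^{\frac12})^{-1}$. $\mathrm{vec}_t(\mathcal{A})\in\mathbb{K}_l^{mn}$ stacks vertically the lateral slices $\mathcal{A}_{(:,1,:)},\dots,\mathcal{A}_{(:,n,:)}$. The t-Kronecker product $\mathcal{A}\otimes_t\mathcal{B}$ is the block tubal matrix with $(i,j)$ block $\mathcal{A}_{(i,j,:)}*\mathcal{B}$ (the tube $\mathcal{A}_{(i,j,:)}\in\mathbb{K}_l^{1\times1}$ being t-multiplied with every tube of $\mathcal{B}$). Weighted norm: $\|\mathcal{X}\|_{F(\mathcal{M},\mathcal{N})}^{2}=\langle(\mathcal{N}^{ST}\otimes_t\mathcal{M})*\mathrm{vec}_t(\mathcal{X}),\mathrm{vec}_t(\mathcal{X})\rangle$, which equals $\|\mathcal{M}^{\frac12}*\mathcal{X}*\mathcal{N}^{\frac12}\|_F^2$.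 Expectations of tubal matrices are entrywise; $\lambda_{\min}$ is the smallest eigenvalue. *)

(* Defs.v *)
From HB Require Import structures.
From mathcomp Require Import all_boot all_order all_algebra.
From mathcomp Require Import all_classical all_reals all_analysis measurable_realfun.

Set Implicit Arguments.
Unset Strict Implicit.
Unset Printing Implicit Defensive.

Import Order.TTheory GRing.Theory Num.Theory.
Local Open Scope classical_set_scope.
Local Open Scope ring_scope.

(* Slices are numbered from 0.  The operations that use the cyclic structure   *)
(* are defined for l.+1 slices, so that index arithmetic modulo the number of  *)
(* slices is the arithmetic of the additive group 'I_l.+1.                     *)

Definition tubal (R : realType) (l m n : nat) := {ffun 'I_l -> 'M[R]_(m, n)}.

HB.instance Definition _ (R : realType) (l m n : nat) :=
  GRing.Lmodule.copy (tubal R l m n) {ffun 'I_l -> 'M[R]_(m, n)}.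
HB.instance Definition _ (R : realType) (l m n : nat) :=
  isPointed.Build (tubal R l m n) 0.

Section TubalAlgebra.
Variables (R : realType) (l : nat).
Local Notation K := (tubal R l.+1).

Definition tunfold m n (A : K m n) : 'M[R]_(\sum_(p < l.+1) m, n) :=
  \mxcol_(p < l.+1) A p.

Definition tfold m n (U : 'M[R]_(\sum_(p < l.+1) m, n)) : K m n :=
  [ffun p => submxcol U p].

Definition bcirc m n (A : K m n) :
    'M[R]_(\sum_(p < l.+1) m, \sum_(q < l.+1) n) :=
  \mxblock_(p < l.+1, q < l.+1) A (p - q).

Definition tprod m n p (A : K m n) (B : K n p) : K m p :=
  tfold (bcirc A *m tunfold B).
Local Notation "A ** B" := (tprod A B) (at level 40, left associativity).

Definition tid n : K n n := [ffun k => if k == 0 then 1%:M else 0].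

(* With slices numbered from 0, slice l - k + 2 is slice - k modulo l. *)
Definition ttr m n (A : K m n) : K n m := [ffun k => (A (- k))^T].

Definition str m n (A : K m n) : K n m := [ffun k => (A k)^T].

(* 0 if A is not invertible *)
Definition tinv n (A : K n n) : K n n :=
  xget 0 [set Y | A ** Y = tid n /\ Y ** A = tid n].

Definition is_tpinv m n (A : K m n) (Y : K n m) :=
  [/\ A ** Y ** A = A, Y ** A ** Y = Y,
      ttr (A ** Y) = A ** Y & ttr (Y ** A) = Y ** A].

Definition tpinv m n (A : K m n) : K n m := xget 0 [set Y | is_tpinv A Y].

Definition tdot m n (A B : K m n) : R :=
  \sum_(k < l.+1) \sum_(i < m) \sum_(j < n) A k i j * B k i j.

Definition tsymmetric n (M : K n n) := M = ttr M.

Definition tsym_posdef n (M : K n n) :=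
  tsymmetric M /\ forall X : K n 1, X != 0 -> 0 < tdot X (M ** X).

(* The square root of a symmetric positive semidefinite matrix: its unique    *)
(* symmetric positive semidefinite square root.                               *)
Definition is_mxsqrt n (B Q : 'M[R]_n) :=
  [/\ Q^T = Q, forall x : 'cV[R]_n, 0 <= (x^T *m Q *m x) 0 0 & Q *m Q = B].

Definition mxsqrt n (B : 'M[R]_n) : 'M[R]_n := xget 0 [set Q | is_mxsqrt B Q].

Definition tsqrt n (M : K n n) : K n n :=
  xget 0 [set Y | bcirc Y = mxsqrt (bcirc M)].

Definition vec_t m n (A : K m n) : K (\sum_(j < n) m) 1 :=
  [ffun k => \mxcol_(j < n) col j (A k)].

Definition tube m n (A : K m n) (i : 'I_m) (j : 'I_n) : K 1 1 :=
  [ffun k => (A k i j)%:M].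

Definition tube_prod m n (a : K 1 1) (B : K m n) : K m n :=
  [ffun k => \matrix_(i, j) (a ** tube B i j) k 0 0].

Definition tkron m n p q (A : K m n) (B : K p q) :
    K (\sum_(i < m) p) (\sum_(j < n) q) :=
  [ffun k => \mxblock_(i < m, j < n) tube_prod (tube A i j) B k].

Definition wnorm_sq m n (M : K m m) (N : K n n) (X : K m n) : R :=
  tdot (tkron (str N) M ** vec_t X) (vec_t X).

End TubalAlgebra.

Notation "A ** B" := (tprod A B) (at level 40, left associativity) : ring_scope.

(* The infimum is attained for a real symmetric matrix of positive size. *)
Definition lambda_min (R : realType) n (B : 'M[R]_n) : R :=
  inf [set a | eigenvalue B a].

Definition tubal_display : measure_display.
Proof. exact: default_measure_display. Qed.

Section TubalMeasurable.
Variables (R : realType) (l m n : nat).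

(* The smallest sigma-algebra making all the entries measurable, i.e. the     *)
(* Borel sigma-algebra of R^(m x n x l).                                      *)
Definition tubal_measurable : set (set (tubal R l m n)) :=
  <<s \bigcup_(e in [set: 'I_l * 'I_m * 'I_n])
        preimage_set_system setT (fun A : tubal R l m n => A e.1.1 e.1.2 e.2)
          measurable >>.

Let tubal_measurable0 : tubal_measurable set0.
Proof. exact: sigma_algebra0. Qed.

Let tubal_measurableC A : tubal_measurable A -> tubal_measurable (~` A).
Proof. exact: sigma_algebraC. Qed.

Let tubal_measurable_bigcup (F : (set (tubal R l m n))^nat) :
  (forall i, tubal_measurable (F i)) -> tubal_measurable (\bigcup_i F i).
Proof. exact: sigma_algebra_bigcup. Qed.

HB.instance Definition _ := @isMeasurable.Build tubal_display (tubal R l m n)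
  tubal_measurable tubal_measurable0 tubal_measurableC tubal_measurable_bigcup.

End TubalMeasurable.

Section Expectation.
Context (d : measure_display) (T : measurableType d) (R : realType).
Variable P : probability T R.

Definition mxexpect m n (F : T -> 'M[R]_(m, n)) : 'M[R]_(m, n) :=
  \matrix_(i, j) fine ('E_P[fun w => F w i j])%E.

Definition texpect l m n (F : T -> tubal R l m n) : tubal R l m n :=
  [ffun k => mxexpect (fun w => F w k)].

(* Y is a version of the conditional expectation, given the sigma-algebra F,  *)
(* of the nonnegative function f (which is not required to be integrable).    *)
Definition is_cond_expectation (F : set (set T)) (f Y : T -> \bar R) :=
  [/\ forall B : set (\bar R), measurable B -> F (Y @^-1` B),
      forall w, (0 <= Y w)%E
    & forall E, F E -> (\int[P]_(w in E) Y w = \int[P]_(w in E) f w)%E].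

End Expectation.

Definition generated_by d d' (T : measurableType d) (T' : measurableType d')
    (X : T -> T') : set (set T) :=
  preimage_set_system setT X measurable.

Section Tesp.
Variables (R : realType) (l m n r s tau zeta : nat).
Local Notation K := (tubal R l.+1).
Variables (A : K m r) (B : K s n) (C : K m n) (M : K r r) (N : K s s).

Definition sketchE (S : K m tau) : K m m :=
  S ** tpinv (ttr S ** A ** tinv M ** ttr A ** S) ** ttr S.

Definition sketchG (V : K n zeta) : K n n :=
  V ** tpinv (ttr V ** ttr B ** tinv N ** B ** V) ** ttr V.

Definition sketchZ (S : K m tau) : K r r :=
  tinv (tsqrt M) ** ttr A ** sketchE S ** A ** tinv (tsqrt M).

Definition sketchW (V : K n zeta) : K s s :=
  tinv (tsqrt N) ** B ** sketchG V ** ttr B ** tinv (tsqrt N).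

Fixpoint tesp (X0 : K r s) (S : nat -> K m tau) (V : nat -> K n zeta)
    (t : nat) : K r s :=
  if t is t'.+1 then
    let X := tesp X0 S V t' in
    X - tinv M ** ttr A ** sketchE (S t') ** (A ** X ** B - C)
          ** sketchG (V t') ** ttr B ** tinv N
  else X0.

(* Independence of S and V is expressed by the product distribution. *)
Definition rho_tesp (DS : probability (K m tau) R)
    (DV : probability (K n zeta) R) : R :=
  1 - lambda_min (mxexpect (DS \x DV)%E
        (fun SV => bcirc (tkron (sketchW SV.2) (sketchZ SV.1)))).

Context (d : measure_display) (Omega : measurableType d).

(* The sigma-algebra generated by X0 and by the draws of the steps before t. *)
Definition past (X0 : Omega -> K r s) (S : nat -> Omega -> K m tau)
    (V : nat -> Omega -> K n zeta) (t : nat) : set (set Omega) :=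
  <<s generated_by X0 `|`
      \bigcup_(i in [set i | (i < t)%N])
        (generated_by (S i) `|` generated_by (V i)) >>.

(* For every t, the past, S t and V t are mutually independent, with S t and  *)
(* V t of respective distributions DS and DV.  As the three sigma-algebras    *)
(* contain Omega, the product rule for triples yields the one for pairs.      *)
Definition fresh_draws (P : probability Omega R) (DS : probability (K m tau) R)
    (DV : probability (K n zeta) R) (X0 : Omega -> K r s)
    (S : nat -> {mfun Omega >-> K m tau})
    (V : nat -> {mfun Omega >-> K n zeta}) :=
  forall t : nat,
  [/\ forall U, measurable U -> distribution P (S t) U = DS U,
      forall U, measurable U -> distribution P (V t) U = DV U
    & forall E F G, past X0 (fun i => S i) (fun i => V i) t E ->
        generated_by (S t) F -> generated_by (V t) G ->
        P (E `&` F `&` G) = (P E * P F * P G)%E].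

End Tesp.

(* Main.v *)
Require Import Defs.
From HB Require Import structures.
From mathcomp Require Import all_boot all_order all_algebra.
From mathcomp Require Import all_classical all_reals all_analysis measurable_realfun.
From mathcomp Require Import ring lra zify.

(* In the coordinates Xi = M^(1/2) * (X^t - X^star) * N^(1/2) the weighted      *)
(* error is |Xi|^2 and a step is Xi |-> Xi - Z * Xi * W.  As Z and W are         *)
(* orthogonal projections, |Xi - Z * Xi * W|^2 = |Xi|^2 - <Xi, Z * Xi * W>, whose *)
(* mean over the fresh draws is |Xi|^2 - <Xi, E[Z] * Xi * E[W]>.                 *)
(*   The operator Xi |-> E[Z] * Xi * E[W] is represented by E[W]^ST (x) E[Z], not *)
(* by the E[W] (x) E[Z] of the rate; both have the same smallest eigenvalue      *)
(* because W = W^T makes W^ST the conjugate of W.                                *)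
(*   Pseudo-inverses and square roots are obtained from a functional calculus    *)
(* for real symmetric matrices: their values on a block circulant matrix are     *)
(* polynomials in it, hence block circulant.  Z is a measurable function of the  *)
(* draw by the Tikhonov formula H^+ = lim H (H^2 + e)^-1.                        *)

Set Implicit Arguments.
Unset Strict Implicit.
Unset Printing Implicit Defensive.

Import Order.TTheory GRing.Theory Num.Theory.
Import numFieldNormedType.Exports.
Local Open Scope classical_set_scope.
Local Open Scope ring_scope.

(** * Real symmetric matrices *)

(** From projections to a rate. Entries of a projection are bounded by 1, and Z and W are
    independent, so the mean of any expression bilinear in (Z, W) is its value at (E[Z], E[W])
    ([expect_bilinear]). This yields the mean of one step ([expect_step]) and identifies the matrix
    in the rate as the block circulant of E[W] (x) E[Z] ([expect_kron]). The eigenvalue estimate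
    [lambda_min_tkron] then bounds the mean by rho times the current squared error, for each fixed
    error ([rho_contraction]).

    From one step to the conditional expectation. The current error is a function of the past, and
    the next draws are independent of the past. Inside an integral over any past event they can
    therefore be integrated out against their product law ([integral_indep]), and one step contracts
    that integral by rho ([sqerr_step]). For events generated by X^0 this iterates to the factor
    rho^t ([sqerr_le]). A version Y of the conditional expectation has the same integrals as the
    error over such events; comparing them on the events where Y exceeds the bound and the initial
    error is at most q, for every natural q, gives the almost sure inequality ([sqerr_cond]). The
    truncation by q makes these integrals finite, since the initial error may fail to be
    integrable. *)

Definition mxdot (R : realType) m n (X Y : 'M[R]_(m, n)) : R := \tr (X *m Y^T).

Section Mxdot.
Variable R : realType.

Lemma mxdotE m n (X Y : 'M[R]_(m, n)) :
  mxdot X Y = \sum_i \sum_j X i j * Y i j.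
Proof.
by apply: eq_bigr => i _; rewrite mxE; apply: eq_bigr => j _; rewrite mxE.
Qed.

Lemma mxdotC m n (X Y : 'M[R]_(m, n)) : mxdot X Y = mxdot Y X.
Proof. by rewrite /mxdot -mxtrace_tr trmx_mul trmxK. Qed.

Lemma mxdotDl m n (X X' Y : 'M[R]_(m, n)) :
  mxdot (X + X') Y = mxdot X Y + mxdot X' Y.
Proof. by rewrite /mxdot mulmxDl mxtraceD. Qed.

Lemma mxdotZl m n a (X Y : 'M[R]_(m, n)) : mxdot (a *: X) Y = a * mxdot X Y.
Proof. by rewrite /mxdot -scalemxAl mxtraceZ. Qed.

Lemma mxdotDr m n (X Y Y' : 'M[R]_(m, n)) :
  mxdot X (Y + Y') = mxdot X Y + mxdot X Y'.
Proof. by rewrite mxdotC mxdotDl !(mxdotC _ X). Qed.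

Lemma mxdotZr m n a (X Y : 'M[R]_(m, n)) : mxdot X (a *: Y) = a * mxdot X Y.
Proof. by rewrite mxdotC mxdotZl mxdotC. Qed.

Lemma mxdot0l m n (Y : 'M[R]_(m, n)) : mxdot 0 Y = 0.
Proof. by rewrite /mxdot mul0mx mxtrace0. Qed.

Lemma mxdot_mulr m n p (X : 'M[R]_(m, n)) (B : 'M[R]_(n, p)) (Y : 'M[R]_(m, p)) :
  mxdot (X *m B) Y = mxdot X (Y *m B^T).
Proof. by rewrite /mxdot trmx_mul trmxK mulmxA. Qed.

Lemma mxdot_tr m n (X Y : 'M[R]_(m, n)) : mxdot X^T Y^T = mxdot X Y.
Proof. by rewrite /mxdot trmxK mxtrace_mulC -mxtrace_tr trmx_mul trmxK. Qed.

Lemma mxdot_ge0 m n (X : 'M[R]_(m, n)) : 0 <= mxdot X X.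
Proof.
rewrite mxdotE; apply: sumr_ge0 => i _; apply: sumr_ge0 => j _.
by rewrite -expr2 sqr_ge0.
Qed.

Lemma mxdot_sqr_le m n (X : 'M[R]_(m, n)) i j : X i j ^+ 2 <= mxdot X X.
Proof.
rewrite mxdotE (bigD1 i)//= (bigD1 j)//= -expr2 -addrA lerDl.
rewrite addr_ge0//; first by apply: sumr_ge0 => ? _; rewrite -expr2 sqr_ge0.
by apply: sumr_ge0 => ? _; apply: sumr_ge0 => ? _; rewrite -expr2 sqr_ge0.
Qed.

Lemma mxdot_eq0 m n (X : 'M[R]_(m, n)) : mxdot X X = 0 -> X = 0.
Proof.
move=> X0; apply/matrixP => i j; rewrite mxE; apply/eqP.
by rewrite -sqrf_eq0 eq_le sqr_ge0 -X0 mxdot_sqr_le.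
Qed.

Lemma mxdot_gt0 m n (X : 'M[R]_(m, n)) : X != 0 -> 0 < mxdot X X.
Proof.
move=> X0; rewrite lt_neqAle mxdot_ge0 andbT eq_sym.
by apply: contra_neq X0; exact: mxdot_eq0.
Qed.

End Mxdot.

Section SymmetricMatrix.
Variables (R : realType) (n : nat).
Implicit Types (B U Q : 'M[R]_n) (x y : 'rV[R]_n).

Lemma continuous_mulmx_coord p (B : 'M[R]_(n, p)) j :
  continuous (fun x : 'rV[R]_n => (x *m B) 0 j).
Proof.
under eq_fun do rewrite mxE.
apply: (continuous_big add_continuous) => i _ x.
by apply: continuousM; [exact: coord_continuous|exact: cst_continuous].
Qed.

Lemma continuous_mxdot_mulmx B :
  continuous (fun x : 'rV[R]_n => mxdot (x *m B) x).
Proof.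
under eq_fun do rewrite mxdotE big_ord1.
apply: (continuous_big add_continuous) => i _ x.
by apply: continuousM; [exact: continuous_mulmx_coord|exact: coord_continuous].
Qed.

(* A minimizer of the Rayleigh quotient on the compact unit sphere of [U].    *)
Lemma min_eigenvector B U : B^T = B -> (U *m B <= U)%MS -> U != 0 ->
  exists x mu, [/\ x != 0, (x <= U)%MS, x *m B = mu *: x &
    forall y, (y <= U)%MS -> mu * mxdot y y <= mxdot (y *m B) y].
Proof.
move=> Bsym Ust /rowV0Pn[u uU u0].
(* The unit sphere of [U], cut out by continuous functions so that it is closed: the factor [1%:M]
   makes the norm an instance of the quadratic form, and membership in [U] is the vanishing of the
   coordinates modulo [U]. *)
pose A := [set x : 'rV[R]_n | mxdot (x *m 1%:M) x = 1] `&`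
  \bigcap_(j in [set: 'I_n]) [set x : 'rV[R]_n | (x *m cokermx U) 0 j = 0].
have AP x : A x <-> mxdot x x = 1 /\ (x <= U)%MS.
  rewrite /A /= mulmx1; split => -[x1 h]; split => //.
    by rewrite submxE; apply/eqP/rowP => j; rewrite [RHS]mxE; exact: h.
  by move=> j _ /=; move: h; rewrite submxE => /eqP ->; rewrite mxE.
have normU y : y != 0 -> (y <= U)%MS -> A ((Num.sqrt (mxdot y y))^-1 *: y).
  move=> y0 yU; apply/AP; split; last exact: scalemx_sub.
  rewrite mxdotZl mxdotZr mulrA -invfM -expr2 sqr_sqrtr ?mxdot_ge0//.
  by rewrite mulVf// gt_eqF// mxdot_gt0.
have A0 : A !=set0 by eexists; exact: normU uU.
have cA : compact A.
  apply: bounded_closed_compact.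
    exists 1; split => // M M1 x /AP[x1 _].
    apply: le_trans (ltW M1); rewrite /Num.Def.normr/= mx_normrE.
    apply: bigmax_le => // -[i j] _ /=; rewrite -(@ler_pXn2r _ 2) ?nnegrE//.
    by rewrite expr1n real_normK ?num_real// -x1 mxdot_sqr_le.
  apply: closedI.
    apply: (preimage_closed (f := fun x => mxdot (x *m 1%:M) x) (D := [set 1])).
      by move=> x _; exact: continuous_mxdot_mulmx.
    exact: closed_eq.
  apply: closed_bigI => j _.
  apply: (preimage_closed (f := fun x => (x *m cokermx U) 0 j) (D := [set 0])).
    by move=> x _; exact: continuous_mulmx_coord.
  exact: closed_eq.
have [x /set_mem xA xmin] := EVT_min_rV A0 cA
  (continuous_subspaceT (continuous_mxdot_mulmx (B := B))).
have /AP[x1 xU] := xA.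
pose mu := mxdot (x *m B) x.
have min y : (y <= U)%MS -> mu * mxdot y y <= mxdot (y *m B) y.
  have [-> _|y0 yU] := eqVneq y 0; first by rewrite mul0mx !mxdot0l mulr0.
  have := xmin _ (mem_set (normU _ y0 yU)).
  rewrite -scalemxAl mxdotZl mxdotZr mulrA -invfM -expr2 sqr_sqrtr ?mxdot_ge0//.
  by rewrite -/mu ler_pdivlMl ?mxdot_gt0// mulrC.
exists x, mu; split => //.
  by apply: contra_eqN x1 => /eqP ->; rewrite mxdot0l eq_sym oner_neq0.
have BU y : (y <= U)%MS -> (y *m B <= U)%MS.
  by move=> yU; apply: submx_trans Ust; exact: submxMr.
(* The residual of the eigenvector equation. It lies in [U] and is orthogonal to [x], so moving [x]
   along it stays in [U] and is controlled by minimality. *)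
have [z zE] : exists z, z = x *m B - mu *: x by exists (x *m B - mu *: x).
have zU : (z <= U)%MS.
  by rewrite zE addmx_sub ?BU// -scaleN1r scalemx_sub// scalemx_sub.
(* The first variation in the direction [z] vanishes. *)
pose c := mxdot (z *m B) z - mu * mxdot z z.
have xz : mxdot x z = 0.
  by rewrite zE -scaleN1r !mxdotDr !mxdotZr x1 mxdotC -/mu mulr1 mulN1r subrr.
have xBz : mxdot (x *m B) z = mxdot z z.
  by rewrite {2}zE mxdotDl -scaleN1r !mxdotZl xz !mulr0 addr0.
have zBx : mxdot (z *m B) x = mxdot z z by rewrite mxdot_mulr Bsym mxdotC.
have quad t : 0 <= t * mxdot z z *+ 2 + t ^+ 2 * c.
  have := min (x + t *: z) (addmx_sub xU (scalemx_sub t zU)).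
  rewrite mulmxDl -scalemxAl !mxdotDl !mxdotDr !mxdotZl !mxdotZr x1 -/mu.
  rewrite xBz zBx (mxdotC z x) xz -subr_ge0.
  move/le_trans; apply; rewrite le_eqVlt; apply/orP; left; apply/eqP.
  by rewrite /c; ring.
have : mxdot z z = 0.
  apply/eqP; rewrite eq_le mxdot_ge0 andbT leNgt; apply/negP => zz.
  have c1 : 0 < `|c| + 1 by rewrite ltr_pwDr.
  (* At this parameter the quadratic is a positive square times [c - 2 (|c| + 1)], which is
     negative. *)
  have := quad (- (mxdot z z / (`|c| + 1))).
  have := ler_norm c; set s := `|c| in c1 *; move=> cs.
  rewrite leNgt => /negP; apply.
  have -> : - (mxdot z z / (s + 1)) * mxdot z z *+ 2 +
     (- (mxdot z z / (s + 1))) ^+ 2 * c =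
     (mxdot z z / (s + 1)) ^+ 2 * (c - (s + 1) *+ 2).
    by field; rewrite gt_eqF.
  by rewrite pmulr_rlt0 ?exprn_gt0 ?divr_gt0//; lra.
by move/mxdot_eq0/eqP; rewrite zE subr_eq0 => /eqP.
Qed.

(** Diagonalizability, in the form used later: an identity between matrices can be tested on
    eigenvectors. As long as the sum of the eigenspaces found is proper, its orthogonal complement
    is stable under [B] and contains an eigenvector, whose eigenvalue must be new. *)
Lemma sym_eigen_full B : B^T = B ->
  exists rs : seq R, uniq rs /\
    forall D : 'M[R]_n,
      (forall a (v : 'rV[R]_n), a \in rs -> v *m B = a *: v -> v *m D = 0) ->
      D = 0.
Proof.
move=> Bsym.
pose V rs := (\big[addsmx/(0 : 'M[R]_n)]_(a <- rs) eigenspace B a)%MS.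
have Vst rs : (V rs *m B <= V rs)%MS.
  elim: rs => [|a rs IH]; first by rewrite /V big_nil mul0mx sub0mx.
  rewrite /V big_cons addsmxMr addsmxS//.
  by rewrite (eigenspaceP (submx_refl _)) scalemx_sub.
suff [rs [urs Vfull]] : exists rs, uniq rs /\ row_full (V rs).
  exists rs; split=> // D hD; apply/eqP.
  suff : (V rs <= kermx D)%MS.
    move=> /(submx_trans (submx_full (1%:M : 'M[R]_n) Vfull)) /sub_kermxP.
    by rewrite mul1mx => ->.
  rewrite /V; have : {subset rs <= rs} by [].
  elim: {1 3}rs => [|a s IH] srs; first by rewrite big_nil sub0mx.
  rewrite big_cons addsmx_sub IH ?andbT => [|x xs]; last first.
    by apply: srs; rewrite inE xs orbT.
  apply/row_subP => i; apply/sub_kermxP/(hD a); first by rewrite srs ?mem_head.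
  exact/eigenspaceP/row_sub.
(* Induction on a bound for the codimension of the sum of the eigenspaces. *)
suff : forall k rs, uniq rs -> (n - \rank (V rs) <= k)%N ->
  exists rs, uniq rs /\ row_full (V rs).
  by move=> /(_ _ [::] isT (leqnn _)).
elim=> [|k IH] rs urs hk.
  by exists rs; split => //; rewrite /row_full eqn_leq rank_leq_col -subn_eq0 -leqn0.
have [Vf|Vnf] := boolP (row_full (V rs)); first by exists rs.
pose U := kermx (V rs)^T.
have U0 : U != 0.
  by rewrite kermx_eq0 /row_free mxrank_tr.
have Ust : (U *m B <= U)%MS.
  apply/sub_kermxP; rewrite -mulmxA -{1}Bsym -trmx_mul.
  by have /submxP[W ->] := Vst rs; rewrite trmx_mul mulmxA mulmx_ker mul0mx.
have [x [mu [x0 xU xmu _]]] := min_eigenvector Bsym Ust U0.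
have xE : (x <= eigenspace B mu)%MS by apply/eigenspaceP.
have xV : ~~ (x <= V rs)%MS.
  apply: contra x0 => /submxP[w wE]; apply/eqP/mxdot_eq0.
  by rewrite /mxdot {2}wE trmx_mul mulmxA (sub_kermxP xU) mul0mx mxtrace0.
apply: (IH (mu :: rs)).
  rewrite /= urs andbT; apply: contra xV => murs.
  by rewrite (submx_trans xE)// /V (big_rem mu)//= addsmxSl.
have : (\rank (V rs) < \rank (V (mu :: rs)))%N.
  apply: rank_ltmx; rewrite ltmxE /V big_cons addsmxSr/=.
  by apply: contra xV; apply: submx_trans; rewrite (submx_trans xE)// addsmxSl.
lia.
Qed.

(* Polynomials in [B]; [horner_mx] is not available since the size of a block *)
(* circulant matrix, a sum, is not syntactically a successor.                 *)
Inductive is_mxpoly B : 'M[R]_n -> Prop :=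
| is_mxpoly1 : is_mxpoly B 1%:M
| is_mxpolyD X Y : is_mxpoly B X -> is_mxpoly B Y -> is_mxpoly B (X + Y)
| is_mxpolyZ a X : is_mxpoly B X -> is_mxpoly B (a *: X)
| is_mxpolyM X : is_mxpoly B X -> is_mxpoly B (X *m B).

Lemma is_mxpoly_mul B X Y : is_mxpoly B X -> is_mxpoly B Y -> is_mxpoly B (X *m Y).
Proof.
move=> pX; elim=> [|Y1 Y2 _ IH1 _ IH2|a Z _ IH|Z _ IH].
- by rewrite mulmx1.
- by rewrite mulmxDr; exact: is_mxpolyD.
- by rewrite -scalemxAr; exact: is_mxpolyZ.
- by rewrite mulmxA; exact: is_mxpolyM.
Qed.

Lemma is_mxpoly_comm B X D : D *m B = B *m D -> is_mxpoly B X -> D *m X = X *m D.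
Proof.
move=> DB; elim=> [|Y1 Y2 _ IH1 _ IH2|a Z _ IH|Z _ IH].
- by rewrite mulmx1 mul1mx.
- by rewrite mulmxDr mulmxDl IH1 IH2.
- by rewrite -scalemxAr -scalemxAl IH.
- by rewrite mulmxA IH -!mulmxA DB.
Qed.

Lemma is_mxpoly_sym B X : B^T = B -> is_mxpoly B X -> X^T = X.
Proof.
move=> Bsym; elim=> [|Y1 Y2 _ IH1 _ IH2|a Z _ IH|Z pZ IH].
- by rewrite trmx1.
- by rewrite raddfD/= IH1 IH2.
- by rewrite linearZ/= IH.
- by rewrite trmx_mul Bsym IH; exact: (is_mxpoly_comm (erefl _) pZ).
Qed.

(** Newton interpolation. Besides the interpolant [Q], the induction carries the nodal polynomial
    [N], the product of the [B - a] over the nodes; [g] and [h] are their values at an eigenvalue. A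
    multiple of [N] can be added without changing the values at earlier nodes. *)
Lemma is_mxpoly_interpolation B (f : R -> R) rs : uniq rs ->
  exists2 Q, is_mxpoly B Q &
    forall a (v : 'rV[R]_n), a \in rs -> v *m B = a *: v -> v *m Q = f a *: v.
Proof.
move=> urs; suff [Q [g [_ [_ [pQ _ Qg _ [gf _]]]]]] : exists Q g N h, 
   [/\ is_mxpoly B Q, is_mxpoly B N,
    forall a (v : 'rV[R]_n), v *m B = a *: v -> v *m Q = g a *: v,
    forall a (v : 'rV[R]_n), v *m B = a *: v -> v *m N = h a *: v &
    {in rs, g =1 f} /\ forall a, (h a == 0) = (a \in rs)].
  by exists Q => // a v ars /Qg ->; rewrite gf.
elim: rs urs => [_|b rs IH /= /andP[brs /IH[Q [g [N [h [pQ pN Qg Nh [gf h0]]]]]]]].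
  exists 1%:M, (fun=> 1), 1%:M, (fun=> 1); split; try exact: is_mxpoly1.
  - by move=> a v _; rewrite mulmx1 scale1r.
  - by move=> a v _; rewrite mulmx1 scale1r.
  - by split => // a; rewrite oner_eq0.
(* Corrects the value at the new node [b]; [h b] is nonzero because [b] is not among the earlier
   nodes. *)
pose c := (f b - g b) / h b.
exists (Q + c *: N), (fun a => g a + c * h a).
exists (N *m B + (- b) *: N), (fun a => (a - b) * h a); split.
- by apply: is_mxpolyD => //; exact: is_mxpolyZ.
- by apply: is_mxpolyD; [exact: is_mxpolyM|exact: is_mxpolyZ].
- move=> a v va; rewrite mulmxDr -scalemxAr (Nh _ _ va) (Qg _ _ va) scalerA.
  by rewrite -scalerDl.
- move=> a v va; rewrite mulmxDr mulmxA -scalemxAr (Nh _ _ va) -scalemxAl va.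
  by rewrite !scalerA -scalerDl; congr (_ *: _); ring.
- split=> [a|a]; last by rewrite mulf_eq0 subr_eq0 h0 inE.
  rewrite inE => /predU1P[->|ars]; last first.
    by rewrite gf// (eqP (etrans (h0 a) ars)) mulr0 addr0.
  by rewrite /c divfK ?h0// addrC subrK.
Qed.

Lemma sym_calculus B : B^T = B ->
  exists rs : seq R,
    (forall D : 'M[R]_n,
       (forall a (v : 'rV[R]_n), a \in rs -> v *m B = a *: v -> v *m D = 0) -> D = 0) /\
    forall f : R -> R, exists2 Q, is_mxpoly B Q &
      forall a (v : 'rV[R]_n), a \in rs -> v *m B = a *: v -> v *m Q = f a *: v.
Proof.
move=> /sym_eigen_full[rs [urs rsfull]]; exists rs; split => // f.
exact: is_mxpoly_interpolation.
Qed.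

End SymmetricMatrix.

(** * Tubal algebra, square roots and pseudo-inverses *)

Section TubalRing.
Variables (R : realType) (l : nat).
Local Notation K := (tubal R l.+1).

Lemma tprodE m n p (A : K m n) (B : K n p) k :
  (A ** B) k = \sum_q A (k - q) *m B q.
Proof.
by rewrite ffunE /bcirc /tunfold mxblockEv mxcol_mul mxcolK mul_mxrow_mxcol.
Qed.

Lemma tunfoldK m n : cancel (@tunfold R l m n) (@tfold R l m n).
Proof. by move=> A; apply/ffunP => k; rewrite ffunE mxcolK. Qed.

Lemma tfoldK m n : cancel (@tfold R l m n) (@tunfold R l m n).
Proof.
by move=> U; rewrite -[RHS]submxcolK; apply: eq_mxcol => k; rewrite ffunE.
Qed.

Lemma tunfoldM m n p (A : K m n) (B : K n p) :
  tunfold (A ** B) = bcirc A *m tunfold B.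
Proof. exact: tfoldK. Qed.

(** As [bcirc] is also linear, multiplicative and compatible with transposition, most laws of the
    t-product are pulled back from those of matrices along this injection. *)
Lemma bcirc_inj m n : injective (@bcirc R l m n).
Proof.
move=> A B; rewrite /bcirc => /eq_mxblockP AB; apply/ffunP => k.
by have := AB k 0; rewrite subr0.
Qed.

Lemma bcircM m n p (A : K m n) (B : K n p) : bcirc (A ** B) = bcirc A *m bcirc B.
Proof.
rewrite /bcirc mul_mxblock; apply/eq_mxblock => i j; rewrite tprodE.
rewrite (reindex_inj (addIr (- j)))/=; apply: eq_bigr => k _.
by congr (A _ *m _); rewrite opprB addrA subrK.
Qed.

Lemma bcircT m n (A : K m n) : bcirc (ttr A) = (bcirc A)^T.
Proof.
by rewrite /bcirc tr_mxblock; apply/eq_mxblock => i j; rewrite ffunE opprB.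
Qed.

Lemma tprod1l m n (A : K m n) : tid R l m ** A = A.
Proof.
apply/ffunP => k; rewrite tprodE (bigD1 k)//= ffunE subrr eqxx mul1mx.
rewrite big1 ?addr0// => q qk; rewrite ffunE subr_eq0 eq_sym (negbTE qk).
by rewrite mul0mx.
Qed.

Lemma bcirc1 n : bcirc (tid R l n) = 1%:M.
Proof. by rewrite -[LHS]mulmx1 -{1}(tfoldK 1%:M) -tunfoldM tprod1l tfoldK. Qed.

Lemma bcircD m n (A B : K m n) : bcirc (A + B) = bcirc A + bcirc B.
Proof.
by rewrite /bcirc -mxblockD; apply/eq_mxblock => i j; rewrite ffunE.
Qed.

Lemma bcircZ m n a (A : K m n) : bcirc (a *: A) = a *: bcirc A.
Proof. by apply/matrixP => b c; rewrite !mxE ffunE mxE. Qed.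

Lemma bcircN m n (A : K m n) : bcirc (- A) = - bcirc A.
Proof. by rewrite -scaleN1r bcircZ scaleN1r. Qed.

Lemma tprod1r m n (A : K m n) : A ** tid R l n = A.
Proof. by apply: bcirc_inj; rewrite bcircM bcirc1 mulmx1. Qed.

Lemma tprodA m n p q (A : K m n) (B : K n p) (C : K p q) :
  A ** (B ** C) = A ** B ** C.
Proof. by apply: bcirc_inj; rewrite !bcircM mulmxA. Qed.

Lemma tprodDl m n p (A B : K m n) (C : K n p) : (A + B) ** C = A ** C + B ** C.
Proof. by apply: bcirc_inj; rewrite !(bcircM, bcircD) mulmxDl. Qed.

Lemma tprodDr m n p (A : K m n) (B C : K n p) : A ** (B + C) = A ** B + A ** C.
Proof. by apply: bcirc_inj; rewrite !(bcircM, bcircD) mulmxDr. Qed.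

Lemma tprodNl m n p (A : K m n) (C : K n p) : (- A) ** C = - (A ** C).
Proof. by apply: bcirc_inj; rewrite !(bcircM, bcircN) mulNmx. Qed.

Lemma tprodNr m n p (A : K m n) (B : K n p) : A ** (- B) = - (A ** B).
Proof. by apply: bcirc_inj; rewrite !(bcircM, bcircN) mulmxN. Qed.

Lemma tprodBl m n p (A B : K m n) (C : K n p) : (A - B) ** C = A ** C - B ** C.
Proof. by rewrite tprodDl tprodNl. Qed.

Lemma tprodBr m n p (A : K m n) (B C : K n p) : A ** (B - C) = A ** B - A ** C.
Proof. by rewrite tprodDr tprodNr. Qed.

Lemma tprodZl m n p a (A : K m n) (C : K n p) : (a *: A) ** C = a *: (A ** C).
Proof. by apply: bcirc_inj; rewrite !(bcircM, bcircZ) scalemxAl. Qed.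

Lemma tprodZr m n p a (A : K m n) (C : K n p) : A ** (a *: C) = a *: (A ** C).
Proof. by apply: bcirc_inj; rewrite !(bcircM, bcircZ) scalemxAr. Qed.

Lemma tprod0l m n p (C : K n p) : (0 : K m n) ** C = 0.
Proof. by rewrite -(scale0r 0) tprodZl scale0r. Qed.

Lemma tprod0r m n p (A : K m n) : A ** (0 : K n p) = 0.
Proof. by rewrite -(scale0r 0) tprodZr scale0r. Qed.

Lemma ttrM m n p (A : K m n) (B : K n p) : ttr (A ** B) = ttr B ** ttr A.
Proof. by apply: bcirc_inj; rewrite !(bcircM, bcircT) trmx_mul. Qed.

Lemma ttrK m n (A : K m n) : ttr (ttr A) = A.
Proof. by apply: bcirc_inj; rewrite !bcircT trmxK. Qed.

Lemma ttr1 n : ttr (tid R l n) = tid R l n.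
Proof. by apply: bcirc_inj; rewrite bcircT bcirc1 trmx1. Qed.

Lemma tdot_slice m n (A B : K m n) : tdot A B = \sum_k mxdot (A k) (B k).
Proof. by apply: eq_bigr => k _; rewrite mxdotE. Qed.

Lemma mxdot_mxcol p (p_ : 'I_p -> nat) n (A B : forall i, 'M[R]_(p_ i, n)) :
  mxdot (\mxcol_i A i) (\mxcol_i B i) = \sum_i mxdot (A i) (B i).
Proof.
rewrite -mxdot_tr /mxdot trmxK tr_mxcol mul_mxrow_mxcol raddf_sum/=.
by apply: eq_bigr => i _; rewrite -[RHS]mxdot_tr /mxdot trmxK.
Qed.

Lemma tdot_unfold m n (A B : K m n) : tdot A B = mxdot (tunfold A) (tunfold B).
Proof. by rewrite tdot_slice mxdot_mxcol. Qed.

Lemma tdotC m n (A B : K m n) : tdot A B = tdot B A.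
Proof. by rewrite !tdot_unfold mxdotC. Qed.

Lemma tunfoldD m n (A B : K m n) : tunfold (A + B) = tunfold A + tunfold B.
Proof. by rewrite /tunfold -mxcolD; apply: eq_mxcol => i; rewrite ffunE. Qed.

Lemma tunfoldZ m n a (A : K m n) : tunfold (a *: A) = a *: tunfold A.
Proof. by apply/matrixP => i j; rewrite !mxE ffunE mxE. Qed.

Lemma tunfold0 m n : tunfold (0 : K m n) = 0.
Proof. by rewrite -(scale0r 0) tunfoldZ scale0r. Qed.

Lemma tdotDl m n (A B C : K m n) : tdot (A + B) C = tdot A C + tdot B C.
Proof. by rewrite !tdot_unfold tunfoldD mxdotDl. Qed.

Lemma tdotZl m n a (A C : K m n) : tdot (a *: A) C = a * tdot A C.
Proof. by rewrite !tdot_unfold tunfoldZ mxdotZl. Qed.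

Lemma tdotBl m n (A B C : K m n) : tdot (A - B) C = tdot A C - tdot B C.
Proof. by rewrite tdotDl -scaleN1r tdotZl mulN1r. Qed.

Lemma tdotBr m n (A B C : K m n) : tdot C (A - B) = tdot C A - tdot C B.
Proof. by rewrite tdotC tdotBl !(tdotC _ C). Qed.

Lemma tdot_ge0 m n (A : K m n) : 0 <= tdot A A.
Proof. by rewrite tdot_unfold mxdot_ge0. Qed.

Lemma tdot_gt0 m n (A : K m n) : A != 0 -> 0 < tdot A A.
Proof.
move=> A0; rewrite tdot_unfold mxdot_gt0//; apply: contra_neq A0 => uA.
by rewrite -[LHS]tunfoldK uA -tunfold0 tunfoldK.
Qed.

Lemma tdot_prodl m n p (A : K m n) (X : K n p) Y :
  tdot (A ** X) Y = tdot X (ttr A ** Y).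
Proof.
rewrite !tdot_unfold !tunfoldM bcircT /mxdot -mulmxA mxtrace_mulC -mulmxA.
by congr (\tr (_ *m _)); rewrite trmx_mul trmxK.
Qed.

Lemma tdot_tr m n (A B : K m n) : tdot (ttr A) (ttr B) = tdot A B.
Proof.
rewrite !tdot_slice (reindex_inj oppr_inj)/=; apply: eq_bigr => k _.
by rewrite !ffunE !opprK mxdot_tr.
Qed.

Lemma tdot_prodr m n p (X : K m n) (A : K n p) Y :
  tdot (X ** A) Y = tdot X (Y ** ttr A).
Proof. by rewrite -tdot_tr ttrM tdot_prodl ttrK -[RHS]tdot_tr ttrM ttrK. Qed.

Lemma tinvP n (A Y : K n n) : A ** Y = tid R l n -> Y ** A = tid R l n ->
  tinv A = Y.
Proof.
move=> AY YA; rewrite /tinv.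
have [_ inv] := xgetPex 0 (ex_intro
  [set Y | A ** Y = tid R l n /\ Y ** A = tid R l n] Y (conj AY YA)).
by set X := xget _ _ in inv *; rewrite -[RHS]tprod1l -inv -tprodA AY tprod1r.
Qed.

(** The inverse of a block circulant matrix is block circulant: its first block column, folded, is a
    right inverse for the t-product, and for square matrices a right inverse is a left inverse. *)
Lemma tinv_unit n (A : K n n) : bcirc A \in unitmx ->
  A ** tinv A = tid R l n /\ tinv A ** A = tid R l n.
Proof.
move=> uA; pose Y := tfold (invmx (bcirc A) *m tunfold (tid R l n)).
have AY : A ** Y = tid R l n.
  by rewrite -[LHS]tunfoldK tunfoldM tfoldK mulKVmx// tunfoldK.
have YA : Y ** A = tid R l n.
  apply: bcirc_inj; rewrite bcircM bcirc1; apply: mulmx1C.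
  by rewrite -bcircM AY bcirc1.
by rewrite (tinvP AY YA).
Qed.

(** Block circulant matrices form an algebra. This brings the square root and the pseudo-inverse of
    [bcirc A] back to tubal matrices. *)
Lemma is_mxpoly_bcirc n (A : K n n) Q : is_mxpoly (bcirc A) Q -> exists Y, bcirc Y = Q.
Proof.
elim=> [|Y1 Y2 _ [X1 <-] _ [X2 <-]|a Z _ [X <-]|Z _ [X <-]].
- by exists (tid R l n); rewrite bcirc1.
- by exists (X1 + X2); rewrite bcircD.
- by exists (a *: X); rewrite bcircZ.
- by exists (X ** A); rewrite bcircM.
Qed.

End TubalRing.

Section SquareRoot.
Variable R : realType.

Definition psd n (B : 'M[R]_n) := forall y : 'rV_n, 0 <= mxdot (y *m B) y.

(** If [z = y *m B] were nonzero, moving [y] slightly against [z] would make the form negative,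
    since its first-order term is twice the squared norm of [z]. *)
Lemma psd_form0 n (B : 'M[R]_n) (y : 'rV_n) : B^T = B -> psd B ->
  mxdot (y *m B) y = 0 -> y *m B = 0.
Proof.
move=> Bsym Bpsd yB0; have [n0|n0] := eqVneq (1%:M : 'M[R]_n) 0.
  by rewrite -[B]mulmx1 n0 !mulmx0.
apply: mxdot_eq0; set z := y *m B.
have [z' z'E] : exists z', z' = z by exists z.
rewrite -z'E; apply/eqP; rewrite eq_le mxdot_ge0 andbT leNgt; apply/negP => zz.
have c0 := Bpsd z'; have c1 : 0 < mxdot (z' *m B) z' + 1 by rewrite ltr_pwDr.
pose t := - (mxdot z' z' / (mxdot (z' *m B) z' + 1)).
have := Bpsd (y + t *: z'); rewrite mulmxDl -scalemxAl !mxdotDl !mxdotDr.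
rewrite !mxdotZl !mxdotZr yB0 (mxdot_mulr z') Bsym -/z -z'E leNgt => /negP; apply.
rewrite /t; set c := mxdot (z' *m B) z' in c0 c1 *.
have -> : 0 + - (mxdot z' z' / (c + 1)) * mxdot z' z' +
   (- (mxdot z' z' / (c + 1)) * mxdot z' z' +
     - (mxdot z' z' / (c + 1)) * (- (mxdot z' z' / (c + 1)) * c)) =
   (mxdot z' z' / (c + 1)) ^+ 2 * (c - (c + 1) *+ 2).
  by field; rewrite gt_eqF.
by rewrite pmulr_rlt0 ?exprn_gt0 ?divr_gt0//; lra.
Qed.

Lemma is_mxsqrtP n (B Q : 'M[R]_n) :
  is_mxsqrt B Q <-> [/\ Q^T = Q, psd Q & Q *m Q = B].
Proof.
have QE (x : 'cV_n) : (x^T *m Q *m x) 0 0 = mxdot (x^T *m Q) x^T.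
  by rewrite /mxdot trmxK [RHS]big_ord1.
split=> -[Qsym Qpsd QQ]; split => // x; last by rewrite QE.
by rewrite -{2}(trmxK x) -[X in mxdot (X *m _)](trmxK x) -QE.
Qed.

Lemma mxsqrt_poly n (B : 'M[R]_n) : B^T = B -> psd B ->
  exists Q, is_mxsqrt B Q /\ is_mxpoly B Q.
Proof.
move=> Bsym Bpsd; have [rs [full calc]] := sym_calculus Bsym.
(* The square of a fourth root is positive semidefinite. *)
have [H pH HE] := calc (fun a => Num.sqrt (Num.sqrt a)).
have Hsym := is_mxpoly_sym Bsym pH.
exists (H *m H); split; last exact: is_mxpoly_mul.
apply/is_mxsqrtP; split=> [|y|].
- by rewrite trmx_mul Hsym.
- by rewrite mulmxA mxdot_mulr Hsym mxdot_ge0.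
- apply/eqP; rewrite -subr_eq0; apply/eqP/full => a v ars va.
  have [->|v0] := eqVneq v 0; first by rewrite mul0mx.
  have a0 : 0 <= a.
    by have := Bpsd v; rewrite va mxdotZl pmulr_lge0// mxdot_gt0.
  have vHH : v *m (H *m H) = Num.sqrt a *: v.
    have vH := HE a v ars va; rewrite mulmxA vH -scalemxAl vH scalerA -expr2.
    by rewrite sqr_sqrtr ?sqrtr_ge0.
  rewrite mulmxBr va (mulmxA v (H *m H)) vHH -scalemxAl vHH scalerA -expr2.
  by rewrite sqr_sqrtr// subrr.
Qed.

(** [Q'] commutes with its square [B], hence with the polynomial [Q], so [(Q - Q') (Q + Q') = 0]. On
    a row of [Q - Q'] the two nonnegative forms add up to zero; both vanish, so [Q] and [Q'] kill
    that row, and the symmetric matrix [Q - Q'] has square zero. *)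
Lemma mxsqrt_uniq n (B Q Q' : 'M[R]_n) : B^T = B -> is_mxpoly B Q ->
  is_mxsqrt B Q -> is_mxsqrt B Q' -> Q = Q'.
Proof.
move=> Bsym pQ /is_mxsqrtP[Qsym Qpsd QQ] /is_mxsqrtP[Q'sym Q'psd Q'Q'].
have QQ' : Q' *m Q = Q *m Q'.
  by apply: is_mxpoly_comm pQ; rewrite -Q'Q' mulmxA.
apply/eqP; rewrite -subr_eq0; apply/eqP/row_matrixP => i.
pose y := row i (Q - Q').
have sum0 : mxdot (y *m Q) y + mxdot (y *m Q') y = 0.
  rewrite -mxdotDl -mulmxDr /y -row_mul.
  by rewrite mulmxBl !mulmxDr QQ Q'Q' QQ' (addrC _ B) subrr row0 mxdot0l.
move/eqP: sum0; rewrite paddr_eq0 ?Qpsd ?Q'psd//.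
move=> /andP[/eqP/(psd_form0 Qsym Qpsd) yQ /eqP/(psd_form0 Q'sym Q'psd) yQ'].
have y0 : y *m (Q - Q') = 0 by rewrite mulmxBr yQ yQ' subrr.
rewrite row0; apply: mxdot_eq0; rewrite -/y {2}/y rowE mxdotC mxdot_mulr.
by rewrite linearB/= Qsym Q'sym y0 mxdotC mxdot0l.
Qed.

Lemma mxsqrtP n (B : 'M[R]_n) : B^T = B -> psd B ->
  is_mxsqrt B (mxsqrt B) /\ is_mxpoly B (mxsqrt B).
Proof.
move=> Bsym Bpsd; have [Q [BQ pQ]] := mxsqrt_poly Bsym Bpsd.
have BQ' : is_mxsqrt B (mxsqrt B).
  exact: (xgetPex 0 (ex_intro [set Q | is_mxsqrt B Q] Q BQ)).
by rewrite -(mxsqrt_uniq Bsym pQ BQ BQ').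
Qed.

End SquareRoot.

Section TubalRoots.
Variables (R : realType) (l : nat).
Local Notation K := (tubal R l.+1).

(** Shows that none of the choices by [xget] falls back on its default: the root of [bcirc M] is a
    polynomial in it, hence block circulant, and a vector in its kernel would contradict
    definiteness. *)
Lemma posdef_sqrt n (M : K n n) : tsym_posdef M ->
  let Q := tsqrt M in let Qi := tinv Q in
  [/\ ttr Q = Q, Q ** Q = M, ttr Qi = Qi & tinv M = Qi ** Qi] /\
  Q ** Qi = tid R l n /\ Qi ** Q = tid R l n.
Proof.
move=> [Msym Mpd] Q Qi.
have Bsym : (bcirc M)^T = bcirc M by rewrite -bcircT -Msym.
have pd (y : 'rV_(\sum_(k < l.+1) n)) : y != 0 -> 0 < mxdot (y *m bcirc M) y.
  move=> y0; have := Mpd (tfold y^T); rewrite tdot_unfold tunfoldM tfoldK.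
  rewrite -(trmxK (bcirc M *m _)) mxdot_tr trmx_mul trmxK Bsym mxdotC; apply.
  by apply: contra_neq y0 => h; rewrite -[LHS]trmxK -[y^T]tfoldK h tunfold0 trmx0.
have psdB : psd (bcirc M).
  move=> y; have [->|/pd/ltW//] := eqVneq y 0.
  by rewrite mul0mx mxdot0l.
have [/is_mxsqrtP[Ssym Spsd SS] /is_mxpoly_bcirc[Y YE]] := mxsqrtP Bsym psdB.
have QE : bcirc Q = mxsqrt (bcirc M).
  exact: (xgetPex 0 (ex_intro [set Y | bcirc Y = mxsqrt (bcirc M)] Y YE)).
have Qsym : ttr Q = Q by apply: bcirc_inj; rewrite bcircT QE.
have QQ : Q ** Q = M by apply: bcirc_inj; rewrite bcircM QE.
have uQ : bcirc Q \in unitmx.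
  rewrite -row_free_unit -kermx_eq0; apply/negPn/negP => /rowV0Pn[y yk /pd].
  by rewrite -QQ bcircM mulmxA (sub_kermxP yk) mul0mx mxdot0l ltxx.
have [QQi QiQ] := tinv_unit uQ.
have Qisym : ttr Qi = Qi.
  apply/esym/tinvP.
    by rewrite -[in LHS]Qsym -ttrM QiQ ttr1.
  by rewrite -[in X in _ ** X]Qsym -ttrM QQi ttr1.
split => //; split => //; apply: tinvP; rewrite -QQ.
  by rewrite tprodA -(tprodA Q Q) QQi tprod1r QQi.
by rewrite tprodA -(tprodA Qi Qi) QiQ tprod1r QiQ.
Qed.

Lemma tpinv_uniq m n (H : K m n) (Y Y' : K n m) :
  is_tpinv H Y -> is_tpinv H Y' -> Y = Y'.
Proof.
move=> [a b c d] [a' b' c' d'].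
have HY : H ** Y' = H ** Y.
  by rewrite -c' -[in LHS]a -tprodA ttrM c c' tprodA a'.
have YH : Y' ** H = Y ** H.
  by rewrite -d' -[in LHS]a -!tprodA tprodA ttrM d d' -tprodA (tprodA H) a'.
by rewrite -b' -tprodA HY tprodA YH b.
Qed.

(** The pseudo-inverse is the function [a |-> a^-1] of [H], hence a polynomial in [bcirc H]: it is
    symmetric and commutes with [H]. *)
Lemma tpinv_sym n (H : K n n) : ttr H = H ->
  [/\ ttr (tpinv H) = tpinv H, H ** tpinv H = tpinv H ** H,
      H ** tpinv H ** H = H & tpinv H ** H ** tpinv H = tpinv H].
Proof.
move=> Hsym; have Bsym : (bcirc H)^T = bcirc H by rewrite -bcircT Hsym.
have [rs [full calc]] := sym_calculus Bsym.
(* The convention [0^-1 = 0] is the value wanted on the kernel. *)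
have [P pP PE] := calc (@GRing.inv R).
have [Y YE] := is_mxpoly_bcirc pP.
have Ysym : ttr Y = Y by apply: bcirc_inj; rewrite bcircT YE (is_mxpoly_sym Bsym pP).
have HY : H ** Y = Y ** H.
  by apply: bcirc_inj; rewrite !bcircM YE; exact: is_mxpoly_comm pP.
have HYH : H ** Y ** H = H.
  apply: bcirc_inj; rewrite !bcircM YE; apply/eqP; rewrite -subr_eq0.
  apply/eqP/full => a v ars va; rewrite mulmxBr !mulmxA va -!scalemxAl.
  rewrite (PE a v ars va) -scalemxAl va !scalerA.
  by have [->|a0] := eqVneq a 0; rewrite ?mul0r ?mulfV// ?mul1r subrr.
have YHY : Y ** H ** Y = Y.
  apply: bcirc_inj; rewrite !bcircM YE; apply/eqP; rewrite -subr_eq0.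
  apply/eqP/full => a v ars va; rewrite mulmxBr !mulmxA (PE a v ars va) -!scalemxAl.
  rewrite va -scalemxAl (PE a v ars va) !scalerA.
  by have [->|a0] := eqVneq a 0; rewrite ?invr0 ?mul0r ?mulVf// ?mul1r subrr.
have pY : is_tpinv H Y by split => //; rewrite ttrM Ysym Hsym HY.
have -> : tpinv H = Y.
  exact: tpinv_uniq (xgetPex 0 (ex_intro [set Y | is_tpinv H Y] Y pY)) pY.
by [].
Qed.

End TubalRoots.

(** * Kronecker products and the contraction rate *)

Section Kronecker.
Variables (R : realType) (l : nat).
Local Notation K := (tubal R l.+1).

Lemma strK m n (A : K m n) : str (str A) = A.
Proof. by apply/ffunP => k; rewrite !ffunE trmxK. Qed.

Lemma str1 n : str (tid R l n) = tid R l n.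
Proof.
by apply/ffunP => k; rewrite !ffunE; case: ifP; rewrite ?trmx1 ?trmx0.
Qed.

Lemma strM m n p (A : K m n) (B : K n p) : str (A ** B) = str B ** str A.
Proof.
apply/ffunP => k; rewrite ffunE !tprodE raddf_sum/=.
rewrite (reindex_inj (can_inj (subKr k)))/=; apply: eq_bigr => q _.
by rewrite subKr !ffunE trmx_mul.
Qed.

Lemma ttr_str m n (A : K m n) : ttr (str A) = str (ttr A).
Proof. by apply/ffunP => k; rewrite !ffunE. Qed.

Lemma tube_prodE p q (a : K 1 1) (B : K p q) k i j :
  tube_prod a B k i j = \sum_u a (k - u) 0 0 * B u i j.
Proof.
rewrite ffunE mxE tprodE summxE; apply: eq_bigr => u _.
by rewrite mxE big_ord1 ffunE !mxE eqxx mulr1n.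
Qed.

(** The slice transpose appears on the right, not [ttr]: the Kronecker product convolves tubes
    without reversing their index, and only the two matrix indices of [A] are exchanged. *)
Lemma tkron_vec m n p q (A : K m n) (B : K p q) (X : K q n) :
  tkron A B ** vec_t X = vec_t (B ** X ** str A).
Proof.
apply/ffunP => k; rewrite tprodE [RHS]ffunE.
have blocks u : tkron A B (k - u) *m vec_t X u =
    \mxcol_i \sum_j tube_prod (tube A i j) B (k - u) *m col j (X u).
  by rewrite -mul_mxblock_mxrow !ffunE.
rewrite (eq_bigr _ (fun u _ => blocks u)) -mxcol_sum.
apply: eq_mxcol => i; apply/colP => a.
rewrite summxE [RHS]mxE tprodE summxE.
under eq_bigr => u _.
  rewrite summxE; under eq_bigr => j _.
    rewrite mxE; under eq_bigr => b _ do rewrite tube_prodE !mxE mulr_suml.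
    over.
  over.
under [RHS]eq_bigr => u _.
  rewrite mxE; under eq_bigr => j _.
    rewrite tprodE summxE mulr_suml.
    under eq_bigr => v _ do rewrite mxE mulr_suml.
    over.
  over.
rewrite exchange_big [RHS]exchange_big /=; apply: eq_bigr => j _.
rewrite [RHS]exchange_big /=; apply: eq_bigr => v _.
rewrite [RHS]exchange_big /=; apply: eq_bigr => b _.
(* Commutativity of the convolution of tubes. *)
rewrite (reindex_inj (can_inj (subKr (k - v))))/=; apply: eq_bigr => u _.
rewrite subKr !ffunE !mxE eqxx mulr1n; rewrite addrAC.
by rewrite -mulrA mulrC.
Qed.

Lemma tdot_vec m n (A B : K m n) : tdot (vec_t A) (vec_t B) = tdot A B.
Proof.
rewrite !tdot_slice; apply: eq_bigr => k _; rewrite !ffunE mxdot_mxcol mxdotE.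
rewrite [RHS]exchange_big/=; apply: eq_bigr => j _; rewrite mxdotE.
by apply: eq_bigr => i _; rewrite big_ord1 !mxE.
Qed.

Lemma wnorm_sqE m n (M : K m m) (N : K n n) (X : K m n) :
  wnorm_sq M N X = tdot (M ** X ** N) X.
Proof. by rewrite /wnorm_sq tkron_vec strK tdot_vec. Qed.

(** Isometric coordinates, as a row because eigenvectors are taken on the left. *)
Definition tcoord m n (X : K m n) := (tunfold (vec_t X))^T.

Lemma tcoord_surj m n v : exists X : K m n, tcoord X = v.
Proof.
exists [ffun k => \matrix_(i, j) submxcol (@tfold R l _ _ v^T k) j i 0].
rewrite /tcoord -[RHS]trmxK -[v^T]tfoldK; congr ((tunfold _)^T).
apply/ffunP => k; rewrite ffunE -[RHS]submxcolK; apply: eq_mxcol => j.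
by apply/colP => i; rewrite [LHS]mxE [in LHS]ffunE [LHS]mxE tunfoldK.
Qed.

Lemma tcoord_dot m n (X Y : K m n) : mxdot (tcoord X) (tcoord Y) = tdot X Y.
Proof. by rewrite mxdot_tr -tdot_unfold tdot_vec. Qed.

Lemma tcoordZ m n a (X : K m n) : tcoord (a *: X) = a *: tcoord X.
Proof.
rewrite /tcoord -linearZ/= -tunfoldZ; congr ((tunfold _)^T).
by apply/ffunP => k; apply/matrixP => i j; rewrite !(ffunE, mxE).
Qed.

Lemma tcoordB m n (X Y : K m n) : tcoord (X - Y) = tcoord X - tcoord Y.
Proof.
rewrite /tcoord -linearB/= -(scaleN1r (tunfold _)) -tunfoldZ -tunfoldD.
congr ((tunfold _)^T); rewrite scaleN1r.
by apply/ffunP => k; apply/matrixP => i j; rewrite !(ffunE, mxE).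
Qed.

Lemma tcoord_inj m n : injective (@tcoord m n).
Proof.
move=> X Y XY; apply/eqP; rewrite -subr_eq0; apply/negPn/negP => /tdot_gt0.
by rewrite -tcoord_dot tcoordB XY subrr mxdot0l ltxx.
Qed.

Lemma tcoord_eq0 m n (X : K m n) : (tcoord X == 0) = (X == 0).
Proof.
have t0 : tcoord (0 : K m n) = 0 by rewrite -(scale0r 0) tcoordZ scale0r.
by rewrite -{1}t0 (inj_eq (@tcoord_inj m n)).
Qed.

Lemma tcoord_kron m n p q (A : K m n) (B : K p q) (X : K q n) :
  tcoord X *m (bcirc (tkron A B))^T = tcoord (B ** X ** str A).
Proof. by rewrite /tcoord -trmx_mul -tunfoldM tkron_vec. Qed.

(** Read on tubal matrices, the operator is [X |-> B ** X ** str A], which is self-adjoint for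
    [tdot]. *)
Lemma tkron_sym m n (A : K m m) (B : K n n) : ttr A = A -> ttr B = B ->
  (bcirc (tkron A B))^T = bcirc (tkron A B).
Proof.
move=> Asym Bsym; set L := bcirc _.
have Lform (u v : 'rV[R]_(\sum_(k < l.+1) \sum_(j < m) n)) :
    mxdot (u *m L^T) v = mxdot u (v *m L^T).
  have [[X <-] [Y <-]] := (tcoord_surj u, tcoord_surj v).
  by rewrite !tcoord_kron !tcoord_dot tdot_prodr tdot_prodl Bsym ttr_str Asym tprodA.
apply/row_matrixP => i; rewrite !rowE; set v := delta_mx _ _.
apply/eqP; rewrite -subr_eq0; apply/eqP/mxdot_eq0; set z := v *m _ - _.
rewrite {2}/z mxdotDr -scaleN1r mxdotZr -Lform mxdot_mulr trmxK.
by rewrite mulN1r subrr.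
Qed.

(** An infimum in the reals bounds its set only if the set is bounded below; the minimum of the
    Rayleigh quotient provides that bound. *)
Lemma lambda_min_le n (B : 'M[R]_n) a : B^T = B -> eigenvalue B a ->
  lambda_min B <= a.
Proof.
move=> Bsym Ba; apply: ge_inf => //.
have n0 : (1%:M : 'M[R]_n) != 0.
  have /eigenvalueP[v _] := Ba; apply: contra_neq => h.
  by rewrite -[v]mulmx1 h mulmx0.
have [_ [mu [_ _ _ mumin]]] := min_eigenvector Bsym (submx1 _) n0.
exists mu => b /eigenvalueP[v vb v0].
by have := mumin v (submx1 _); rewrite vb mxdotZl ler_pM2r ?mxdot_gt0.
Qed.

(** [Y ** D] isolates column [j] of [Y], and [str (ttr Y)] is [Y] with slices reversed, its
    conjugate. The sum of squares on the right shows that the product is nonzero when the tube at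
    [(i, j)] is. *)
Lemma outer_conj_entry m n (Y : K m n) i j :
  let D : K n m := [ffun k => if k == 0 then delta_mx j i else 0] in
  (Y ** D ** str (ttr Y)) 0 i j = \sum_q Y q i j ^+ 2.
Proof.
move=> D; have YD q : (Y ** D) q = Y q *m delta_mx j i.
  rewrite tprodE (bigD1 0)//= big1 ?addr0 => [|u u0]; last first.
    by rewrite ffunE (negbTE u0) mulmx0.
  by rewrite subr0 ffunE eqxx.
rewrite tprodE summxE [RHS](reindex_inj oppr_inj)/=; apply: eq_bigr => q _.
rewrite YD sub0r -mulmxA mxE (bigD1 j)//= big1 ?addr0 => [|a aj].
  rewrite mxE (bigD1 i)//= big1 ?addr0 => [|a ai].
    by rewrite !(ffunE, mxE) !eqxx mul1r.
  by rewrite mxE (negbTE ai) andbF mul0r.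
by rewrite mxE big1 ?mulr0// => b _; rewrite mxE (negbTE aj) mul0r.
Qed.

(* The eigenvector of X |-> Z * X * W^ST is the product of a column of [Y] and *)
(* the conjugate of a row of [Y].                                             *)
Lemma eigen_str m n (Z : K m m) (W : K n n) (Y : K m n) al be :
  ttr W = W -> Y != 0 -> Z ** Y = al *: Y -> Y ** W = be *: Y ->
  exists2 Y' : K m n, Y' != 0 & Z ** Y' ** str W = (al * be) *: Y'.
Proof.
move=> Wsym Y0 ZY YW.
have [k [i [j Yij]]] : exists k i j, Y k i j != 0.
  apply: contra_neqP Y0 => h; apply/ffunP => k.
  apply/matrixP => i j; rewrite ffunE mxE; apply/eqP/negPn/negP => Yij.
  by apply: h; exists k, i, j.
have := outer_conj_entry Y i j; set D := finfun _ => /= Y'ij.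
exists (Y ** D ** str (ttr Y)).
  apply: contra_eq_neq Y'ij => ->; rewrite ffunE mxE eq_sym.
  apply: lt0r_neq0; rewrite (bigD1 k)//=.
  rewrite ltr_pwDl ?exprn_even_gt0//; apply: sumr_ge0 => q _; exact: sqr_ge0.
(* [str] and [ttr] both reverse products, so their composite is multiplicative; it sends the
   T-symmetric [W] to [str W]. *)
have YWc : str (ttr Y) ** str W = be *: str (ttr Y).
  rewrite -[in str W]Wsym -strM -ttrM YW.
  by apply/ffunP => q; apply/matrixP => a b; rewrite !(ffunE, mxE).
by rewrite -!tprodA YWc !tprodZr tprodA ZY tprodZl scalerA mulrC !tprodA.
Qed.

Lemma mulmx_inj_tcoord m n p (L L' : 'M[R]_(\sum_(k < l.+1) \sum_(j < n) m, p)) :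
  (forall Y : K m n, tcoord Y *m L = tcoord Y *m L') -> L = L'.
Proof.
move=> LL'; apply/row_matrixP => i; rewrite !rowE.
by have [Y <-] := tcoord_surj (delta_mx 0 i).
Qed.

(** Let [mu] be the least eigenvalue of [X |-> Z ** X ** W]. This operator commutes with
    [X |-> Z ** X], so they share an eigenvector [Y], with [Z ** Y = al *: Y] and
    [Y ** W = (mu / al) *: Y]. By [eigen_str], [al * (mu / al) = mu] is then an eigenvalue of the
    Kronecker product without the slice transpose, so [lambda_min] is at most [mu]. *)
Lemma lambda_min_tkron m n (Z : K m m) (W : K n n) (X : K m n) :
  tsym_posdef Z -> tsym_posdef W ->
  lambda_min (bcirc (tkron W Z)) * tdot X X <= tdot X (Z ** X ** W).
Proof.
move=> Zpd [Wsym _]; have [Zsym _] := Zpd.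
have [-> | X0] := eqVneq X 0.
  by rewrite tprod0r tprod0l tdot_unfold tunfold0 mxdot0l mulr0.
have [L [LE Lsym]] : exists L,
    (forall Y : K m n, tcoord Y *m L = tcoord (Z ** Y ** W)) /\ L^T = L.
  exists (bcirc (tkron (str W) Z))^T; split => [Y|].
    by rewrite tcoord_kron strK.
  by rewrite trmxK tkron_sym// ttr_str -Wsym.
have [LZ [LZE LZsym]] : exists LZ,
    (forall Y : K m n, tcoord Y *m LZ = tcoord (Z ** Y)) /\ LZ^T = LZ.
  exists (bcirc (tkron (tid R l n) Z))^T; split => [Y|].
    by rewrite tcoord_kron str1 tprod1r.
  by rewrite trmxK tkron_sym// ttr1.
have one0 : (1%:M : 'M[R]_(\sum_(k < l.+1) \sum_(j < n) m)) != 0.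
  apply: contraNneq X0 => h; rewrite -tcoord_eq0.
  by rewrite -[tcoord X]mulmx1 h mulmx0.
have [x [mu [x0 _ xmu mumin]]] := min_eigenvector Lsym (submx1 _) one0.
apply: (@le_trans _ _ (mu * tdot X X)); last first.
  by have := mumin (tcoord X) (submx1 _); rewrite LE !tcoord_dot (tdotC X).
apply: ler_wpM2r; first exact: tdot_ge0.
have LLZ : L *m LZ = LZ *m L.
  by apply: mulmx_inj_tcoord => Y; rewrite !mulmxA LE !LZE LE !tprodA.
have Est : (eigenspace L mu *m LZ <= eigenspace L mu)%MS.
  apply/eigenspaceP; rewrite -mulmxA -LLZ mulmxA scalemxAl.
  by congr (_ *m _); apply/eigenspaceP; exact: submx_refl.
have E0 : eigenspace L mu != 0.
  apply: contra_neq x0 => E0; apply/eqP; rewrite -submx0 -E0.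
  exact/eigenspaceP.
have [y [al [y0 /eigenspaceP yL yal _]]] := min_eigenvector LZsym Est E0.
have [Y YE] := tcoord_surj y; rewrite -{}YE in y0 yL yal.
have {yL} YL : Z ** Y ** W = mu *: Y.
  by apply: tcoord_inj; rewrite -LE yL tcoordZ.
have {yal} YZ : Z ** Y = al *: Y by apply: tcoord_inj; rewrite -LZE yal tcoordZ.
rewrite tcoord_eq0 in y0.
(* Definiteness of [Z] enters through its invertible square root: [Z ** Y = 0] would force
   [Y = 0]. *)
have al0 : al != 0.
  have [[_ QQ _ _] [_ QiQ]] := posdef_sqrt Zpd.
  apply: contra_neq y0 => al0; move: YZ; rewrite al0 scale0r -QQ -tprodA => YZ.
  have QY : tsqrt Z ** Y = 0 by rewrite -[LHS]tprod1l -QiQ -tprodA YZ tprod0r.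
  by rewrite -[LHS]tprod1l -QiQ -tprodA QY tprod0r.
have YW : Y ** W = (al^-1 * mu) *: Y.
  by rewrite -scalerA -YL YZ tprodZl scalerA mulVf// scale1r.
have [Y' Y'0] := eigen_str (esym Wsym) y0 YZ YW.
rewrite mulrA mulfV// mul1r => Y'mu.
apply: lambda_min_le; first by rewrite tkron_sym.
apply/eigenvalueP; exists (tcoord Y'); last by rewrite tcoord_eq0.
rewrite -(tkron_sym (esym Wsym) (esym Zsym)) tcoord_kron Y'mu; exact: tcoordZ.
Qed.

End Kronecker.

(** * Sketch projections and the error after one step *)

Section Sketch.
Variables (R : realType) (l : nat).
Local Notation K := (tubal R l.+1).

(** The two sides play symmetric roles, so each fact about Z transfers to W. *)
Lemma sketchW_Z s n zeta (B : K s n) (N : K s s) (V : K n zeta) :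
  sketchW B N V = sketchZ (ttr B) N V.
Proof. by rewrite /sketchZ /sketchE ttrK. Qed.

Variables (m r tau : nat) (A : K m r) (M : K r r).
Hypothesis hM : tsym_posdef M.
Implicit Type S : K m tau.

Definition sketchF S := ttr S ** A ** tinv (tsqrt M).

Lemma sketchZE S : let F := sketchF S in
  sketchZ A M S = ttr F ** tpinv (F ** ttr F) ** F.
Proof.
have [[_ _ Misym ME] _] := posdef_sqrt hM.
by rewrite /= /sketchF !ttrM Misym ttrK /sketchZ /sketchE ME !tprodA.
Qed.

(** With [F = sketchF A M S], Z is [F^T (F F^T)^+ F], the orthogonal projection onto the range of
    [F^T]; idempotence is the second Penrose equation. *)
Lemma sketchZ_proj S :
  ttr (sketchZ A M S) = sketchZ A M S /\
  sketchZ A M S ** sketchZ A M S = sketchZ A M S.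
Proof.
rewrite sketchZE /=; move: (sketchF S) => F.
have /tpinv_sym[Psym _ _ PHP] : ttr (F ** ttr F) = F ** ttr F.
  by rewrite ttrM ttrK.
split; first by rewrite !ttrM ttrK Psym tprodA.
by rewrite -{3}PHP !tprodA.
Qed.

(** A diagonal entry of slice 0 of [Z ** Z] is the sum of the squares of row [i] over all slices. So
    [Z 0 i i] dominates every such square, its own included, and is at most 1. This bound supplies
    integrability for the expectations. *)
Lemma proj_bound p (Z : K p p) k i j : ttr Z = Z -> Z ** Z = Z ->
  `|Z k i j| <= 1.
Proof.
move=> Zsym Zidem.
have Zii : Z 0 i i = \sum_q \sum_b Z q i b ^+ 2.
  rewrite -[in LHS]Zidem tprodE summxE (reindex_inj oppr_inj)/=.
  apply: eq_bigr => q _; rewrite mxE sub0r opprK; apply: eq_bigr => b _.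
  by rewrite -[in Z (- q)]Zsym ffunE opprK mxE expr2.
have sq_le q b : Z q i b ^+ 2 <= Z 0 i i.
  rewrite Zii (bigD1 q)//= (bigD1 b)//= -addrA lerDl addr_ge0//.
    by apply: sumr_ge0 => ? _; exact: sqr_ge0.
  by apply: sumr_ge0 => ? _; apply: sumr_ge0 => ? _; exact: sqr_ge0.
have Z1 : Z 0 i i <= 1.
  have := sq_le 0 i; rewrite leNgt => h; rewrite leNgt; apply: contra h => h.
  by rewrite expr2 ltr_pMr// (lt_trans ltr01).
rewrite -(@ler_pXn2r _ 2) ?nnegrE// expr1n real_normK ?num_real//.
exact: le_trans (sq_le _ _) Z1.
Qed.

End Sketch.

Section Step.
Variables (R : realType) (l m n r s tau zeta : nat).
Local Notation K := (tubal R l.+1).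
Variables (A : K m r) (B : K s n) (C : K m n) (M : K r r) (N : K s s).
Variables (Xstar : K r s).
Hypotheses (hM : tsym_posdef M) (hN : tsym_posdef N).
Hypothesis hX : A ** Xstar ** B = C.

Definition terr (X : K r s) := tsqrt M ** (X - Xstar) ** tsqrt N.

Lemma wnorm_terr X : wnorm_sq M N (X - Xstar) = tdot (terr X) (terr X).
Proof.
have [[Msym MM _ _] _] := posdef_sqrt hM; have [[Nsym NN _ _] _] := posdef_sqrt hN.
rewrite wnorm_sqE /terr [RHS]tdot_prodr Nsym -!tprodA NN [RHS]tdot_prodl.
by rewrite Msym !tprodA MM tdotC.
Qed.

Lemma terr_step X (S : K m tau) (V : K n zeta) :
  terr (X - tinv M ** ttr A ** sketchE A M S ** (A ** X ** B - C)
          ** sketchG B N V ** ttr B ** tinv N) =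
  terr X - sketchZ A M S ** terr X ** sketchW B N V.
Proof.
have [[_ _ _ ME] [MMi MiM]] := posdef_sqrt hM.
have [[_ _ _ NE] [NNi NiN]] := posdef_sqrt hN.
have -> : A ** X ** B - C = A ** (X - Xstar) ** B by rewrite -hX tprodBr tprodBl.
rewrite /terr; set T := _ ** tinv N; set D := X - Xstar.
have -> : X - T - Xstar = D - T by rewrite addrAC.
rewrite tprodBr tprodBl /T; congr (_ - _).
rewrite ME NE /sketchZ /sketchW !tprodA MMi tprod1l.
rewrite -(tprodA _ (tinv (tsqrt N)) (tsqrt N)) NiN tprod1r.
rewrite -(tprodA _ (tinv (tsqrt M)) (tsqrt M)) MiM tprod1r.
by rewrite -(tprodA _ (tsqrt N) (tinv (tsqrt N))) NNi tprod1r.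
Qed.

Lemma tdot_step X (Z : K r r) (W : K s s) :
  ttr Z = Z -> Z ** Z = Z -> ttr W = W -> W ** W = W ->
  tdot (X - Z ** X ** W) (X - Z ** X ** W) = tdot X X - tdot X (Z ** X ** W).
Proof.
move=> Zs ZZ Ws WW; rewrite tdotBl !tdotBr.
have -> : tdot (Z ** X ** W) (Z ** X ** W) = tdot (Z ** X ** W) X.
  rewrite tdot_prodr Ws -(tprodA _ W) WW -(tprodA Z X W) tdot_prodl Zs.
  by rewrite !tprodA ZZ tdotC.
by rewrite subrr subr0.
Qed.

End Step.

(** * Measurability *)

Section Resolvent.
Variable R : realType.

(** [G + e%:M] stretches every vector by at least [e]; applied to the rows of the inverse, this
    bounds their norm by [1 / e]. *)
Lemma psd_resolvent n (G : 'M[R]_n) e : G^T = G -> psd G -> 0 < e ->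
  G + e%:M \in unitmx /\
  forall i j, `|(e *: invmx (G + e%:M)) i j| <= 1.
Proof.
move=> Gsym Gpsd e0.
have Ge (y : 'rV_n) :
    e ^+ 2 * mxdot y y <= mxdot (y *m (G + e%:M)) (y *m (G + e%:M)).
  rewrite mulmxDr mul_mx_scalar !mxdotDl !mxdotDr !mxdotZl !mxdotZr.
  rewrite (mxdotC y (y *m G)) -subr_ge0.
  have -> : mxdot (y *m G) (y *m G) + e * mxdot (y *m G) y +
      (e * mxdot (y *m G) y + e * (e * mxdot y y)) - e ^+ 2 * mxdot y y =
      mxdot (y *m G) (y *m G) + e * mxdot (y *m G) y *+ 2 by ring.
  by rewrite addr_ge0 ?mxdot_ge0// mulrn_wge0// mulr_ge0 ?Gpsd// ltW.
have uG : G + e%:M \in unitmx.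
  rewrite -row_free_unit -kermx_eq0; apply/negPn/negP => /rowV0Pn[y /sub_kermxP yk].
  move/mxdot_gt0; rewrite ltNge => /negP; apply.
  have := Ge y; rewrite yk mxdot0l pmulr_rle0//; exact: exprn_gt0.
split => // i j.
pose y : 'rV_n := row i (invmx (G + e%:M)).
have yE : y *m (G + e%:M) = row i 1%:M by rewrite -row_mul mulVmx.
have := Ge y; rewrite yE => h.
have -> : (e *: invmx (G + e%:M)) i j = (e *: y) 0 j by rewrite !mxE.
rewrite -(@ler_pXn2r _ 2) ?nnegrE// expr1n real_normK ?num_real//.
apply: le_trans (mxdot_sqr_le _ _ _) _.
rewrite mxdotZl mxdotZr mulrA -expr2; apply: le_trans h _.
rewrite mxdotE big_ord1 (bigD1 i)//= big1 => [|k ki].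
  by rewrite !mxE eqxx mulr1 addr0.
by rewrite !mxE eq_sym (negbTE ki) mulr0.
Qed.

(* [P - H (H^2 + e)^-1 = e P^3 (1 - e (H^2 + e)^-1)], with a bounded last factor. *)
Lemma pinv_cvg n (H P : 'M[R]_n) i j : H^T = H -> H *m P = P *m H ->
  H *m P *m H = H -> P *m H *m P = P ->
  (fun k : nat => (H *m invmx (H *m H + (k.+1%:R^-1)%:M)) i j) @ \oo --> P i j.
Proof.
move=> Hsym HP HPH PHP.
have Gsym : (H *m H)^T = H *m H by rewrite trmx_mul Hsym.
have Gpsd : psd (H *m H).
  by move=> y; rewrite mulmxA mxdot_mulr Hsym mxdot_ge0.
have diff (e : R) : 0 < e -> `|(H *m invmx (H *m H + e%:M)) i j - P i j| <=
    e * (2 * \sum_k `|(P *m P *m P) i k|).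
  move=> e0; have [uG bnd] := psd_resolvent Gsym Gpsd e0.
  move: bnd uG; set G := H *m H + e%:M => bnd uG.
  have PHH : P *m (H *m H) = H by rewrite mulmxA -HP HPH.
  have PPP : P *m P *m P *m (H *m H) = P.
    by rewrite -mulmxA PHH -mulmxA -HP mulmxA PHP.
  have dE : H *m invmx G - P = - (e *: (P *m P *m P *m (1%:M - e *: invmx G))).
    have -> : 1%:M - e *: invmx G = H *m H *m invmx G.
      by rewrite -(mulmxV uG) {1}/G mulmxDl mul_scalar_mx addrK.
    have -> : H *m invmx G = P - e *: (P *m invmx G).
      rewrite -{1}PHH -[H *m H](addrK e%:M) -/G mulmxBr mulmxBl mulmxK//.
      by rewrite mul_mx_scalar scalemxAl.
    by rewrite (mulmxA _ (H *m H)) PPP addrAC subrr add0r.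
  have -> : (H *m invmx G) i j - P i j = (H *m invmx G - P) i j by rewrite !mxE.
  rewrite dE mxE normrN mxE normrM (gtr0_norm e0).
  apply: ler_wpM2l; [exact: ltW|rewrite mxE].
  apply: le_trans (ler_norm_sum _ _ _) _; rewrite mulr_sumr.
  apply: ler_sum => k _; rewrite normrM mulrC ler_wpM2r//.
  rewrite !mxE; apply: le_trans (ler_normB _ _) _.
  have := bnd k j; rewrite mxE => /(lerD _); apply.
  by rewrite normr_nat; case: eqP.
have [c c0 cE] : exists2 c, 0 <= c & 2 * \sum_k `|(P *m P *m P) i k| = c.
  by eexists; last reflexivity; rewrite mulr_ge0// sumr_ge0.
rewrite {}cE in diff.
have c1 : 0 < c + 1 by rewrite ltr_pwDr.
apply/cvgrPdist_le => e e0.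
have ec : 0 < e / (c + 1) by rewrite divr_gt0.
have := @near_infty_natSinv_lt R (PosNum ec).
apply: filterS => k /= ke; rewrite distrC.
apply: le_trans (diff _ _) _; first by rewrite invr_gt0.
apply: le_trans (ler_wpM2r c0 (ltW ke)) _.
by rewrite -mulrA ler_piMr ?(ltW e0)// ler_pdivrMl// mulr1 lerDl.
Qed.

End Resolvent.

Section MeasurableEntries.
Context d (T : measurableType d) (R : realType).

Definition mx_measurable m n (F : T -> 'M[R]_(m, n)) :=
  forall i j, measurable_fun setT (fun w => F w i j).

Definition t_measurable l m n (F : T -> tubal R l m n) :=
  forall k, mx_measurable (fun w => F w k).

Lemma mx_measurable_cst m n (A : 'M[R]_(m, n)) : mx_measurable (fun=> A).
Proof. by move=> i j; exact: measurable_cst. Qed.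

Lemma mx_measurableM m n p (F : T -> 'M[R]_(m, n)) (G : T -> 'M[R]_(n, p)) :
  mx_measurable F -> mx_measurable G -> mx_measurable (fun w => F w *m G w).
Proof.
move=> mF mG i j; under eq_fun do rewrite mxE.
by apply: measurable_sum => k; exact: measurable_funM.
Qed.

Lemma mx_measurableD m n (F G : T -> 'M[R]_(m, n)) :
  mx_measurable F -> mx_measurable G -> mx_measurable (fun w => F w + G w).
Proof.
by move=> mF mG i j; under eq_fun do rewrite mxE; exact: measurable_funD.
Qed.

Lemma measurable_det n (F : T -> 'M[R]_n) : mx_measurable F ->
  measurable_fun setT (fun w => \det (F w)).
Proof.
move=> mF; apply: measurable_sum => s; apply: measurable_funM => //.
by apply: measurable_prod.
Qed.

(** The inverse is rewritten as [f] times a real power of [f ^+ 2]; at a zero of [f] both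
    expressions are 0. *)
Lemma measurable_funV (f : T -> R) : measurable_fun setT f ->
  measurable_fun setT (fun w => (f w)^-1).
Proof.
move=> mf; under eq_fun => w.
  have -> : (f w)^-1 = f w * (f w ^+ 2) `^ (-1).
    have [->|f0] := eqVneq (f w) 0; first by rewrite invr0 mul0r.
    by rewrite powR_inv1 ?sqr_ge0// expr2 invfM mulrA mulfV// mul1r.
  over.
apply: measurable_funM => //; apply: (measurableT_comp (measurable_powR _)).
exact: measurable_funX.
Qed.

Lemma mx_measurable_inv n (F : T -> 'M[R]_n) :
  (forall w, F w \in unitmx) -> mx_measurable F ->
  mx_measurable (fun w => invmx (F w)).
Proof.
move=> uF mF i j; under eq_fun do rewrite /invmx uF !mxE.
apply: measurable_funM; first exact/measurable_funV/measurable_det.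
apply: measurable_funM => //; apply: measurable_det => a b.
under eq_fun do rewrite !mxE.
exact: mF.
Qed.

Variable l : nat.
Local Notation K := (tubal R l.+1).

Lemma t_measurable_cst m n (A : K m n) : t_measurable (fun=> A).
Proof. by move=> k; exact: mx_measurable_cst. Qed.

Lemma t_measurableM m n p (F : T -> K m n) (G : T -> K n p) :
  t_measurable F -> t_measurable G -> t_measurable (fun w => F w ** G w).
Proof.
move=> mF mG k i j; under eq_fun do rewrite tprodE summxE.
by apply: measurable_sum => q; exact: mx_measurableM.
Qed.

Lemma t_measurableD m n (F G : T -> K m n) :
  t_measurable F -> t_measurable G -> t_measurable (fun w => F w + G w).
Proof.
by move=> mF mG k; under eq_fun do rewrite ffunE; exact: mx_measurableD.
Qed.

Lemma t_measurableN m n (F : T -> K m n) :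
  t_measurable F -> t_measurable (fun w => - F w).
Proof.
move=> mF k i j; under eq_fun do rewrite ffunE mxE.
by apply: measurableT_comp; [exact: oppr_measurable|exact: mF].
Qed.

Lemma t_measurableT m n (F : T -> K m n) :
  t_measurable F -> t_measurable (fun w => ttr (F w)).
Proof.
move=> mF k i j; under eq_fun do rewrite ffunE mxE.
exact: mF.
Qed.

Lemma measurable_tdot m n (F G : T -> K m n) :
  t_measurable F -> t_measurable G -> measurable_fun setT (fun w => tdot (F w) (G w)).
Proof.
move=> mF mG; do 3 apply: measurable_sum => ?.
by apply: measurable_funM; [exact: mF|exact: mG].
Qed.

Lemma t_measurable_pinv n (F : T -> K n n) : (forall w, ttr (F w) = F w) ->
  t_measurable F -> t_measurable (fun w => tpinv (F w)).
Proof.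
move=> Fsym mF k i j.
have mbF : mx_measurable (fun w => bcirc (F w)).
  move=> a b; under eq_fun do rewrite !mxE.
  exact: mF.
(* Slice [k] is block [(k, 0)] of the block circulant matrix, so each entry is an entry of an
   ordinary matrix. *)
have bE w : tpinv (F w) k i j =
    bcirc (tpinv (F w)) (tagnat.Rank k i) (tagnat.Rank 0 j).
  have := mxblockK (fun p q => tpinv (F w) (p - q)) k 0.
  by rewrite subr0 => /matrixP/(_ i j) <-; rewrite mxE.
under eq_fun do rewrite bE.
apply: (@measurable_fun_cvg _ _ _ _ (fun h w =>
  (bcirc (F w) *m invmx (bcirc (F w) *m bcirc (F w) + (h.+1%:R^-1)%:M))
    (tagnat.Rank k i) (tagnat.Rank 0 j))).
  move=> h; apply: mx_measurableM => //; apply: mx_measurable_inv => [w|].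
    have bsym : (bcirc (F w))^T = bcirc (F w) by rewrite -bcircT Fsym.
    apply: (psd_resolvent _ _ _).1; rewrite ?invr_gt0//.
      by rewrite trmx_mul bsym.
    by move=> y; rewrite mulmxA mxdot_mulr bsym mxdot_ge0.
  apply: mx_measurableD; first exact: mx_measurableM.
  exact: mx_measurable_cst.
move=> w _; have [_ HP HPH PHP] := tpinv_sym (Fsym w).
apply: pinv_cvg; rewrite -?bcircT -?bcircM; congr bcirc => //.
Qed.

Lemma t_measurable_fun m n (F : T -> K m n) :
  t_measurable F -> measurable_fun setT F.
Proof.
move=> mF; apply: (measurability (\bigcup_(e in [set: 'I_l.+1 * 'I_m * 'I_n])
        preimage_set_system setT (fun A : tubal R l.+1 m n => A e.1.1 e.1.2 e.2)
          measurable)); first by [].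
move=> _ [_ [[[k i] j] _ [U mU <-]]] <-; rewrite !setTI.
by have := mF k i j measurableT _ mU; rewrite setTI.
Qed.

End MeasurableEntries.

Lemma t_measurable_id (R : realType) l m n : 
  t_measurable (fun X : tubal R l m n => X).
Proof.
move=> k i j _ U mU; apply: sub_sigma_algebra.
by exists (k, i, j) => //; exists U.
Qed.

Lemma t_measurable_comp (R : realType) l m n d (T : measurableType d)
  d' (T' : measurableType d') (F : T' -> tubal R l m n) (g : T -> T') :
  measurable_fun setT g -> t_measurable F -> t_measurable (F \o g).
Proof. by move=> mg mF k i j; apply: measurableT_comp (mF k i j) mg. Qed.

Lemma t_measurable_sketchZ (R : realType) l m r tau (A : tubal R l.+1 m r)
    (M : tubal R l.+1 r r) : tsym_posdef M ->
  t_measurable (fun S : tubal R l.+1 m tau => sketchZ A M S).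
Proof.
move=> hM; under eq_fun do rewrite sketchZE//=.
have mF : t_measurable (fun S : tubal R l.+1 m tau => sketchF A M S).
  apply: t_measurableM; last exact: t_measurable_cst.
  apply: t_measurableM; last exact: t_measurable_cst.
  by apply: t_measurableT; exact: t_measurable_id.
apply: t_measurableM => //; apply: t_measurableM; first exact: t_measurableT.
apply: t_measurable_pinv; first by move=> w; rewrite ttrM ttrK.
by apply: t_measurableM => //; exact: t_measurableT.
Qed.

(** * Expectation of a step *)

Section BoundedExpectation.
Context d (T : measurableType d) (R : realType) (P : probability T R).

Lemma bounded_integrable (f : T -> R) (c : R) : measurable_fun setT f ->
  (forall x, `|f x| <= c) -> P.-integrable setT (EFin \o f).
Proof.
move=> mf fc; apply: measurable_bounded_integrable => //.
  by apply: le_lt_trans (ltry 1); exact: probability_le1.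
exists c; split; rewrite ?num_real// => M cM x _ /=.
exact: le_trans (fc x) (ltW cM).
Qed.

Lemma Rintegral_sum I (s : seq I) (f : I -> T -> R) :
  (forall i, P.-integrable setT (EFin \o f i)) ->
  Rintegral P setT (fun x => \sum_(i <- s) f i x) =
  \sum_(i <- s) Rintegral P setT (f i).
Proof.
move=> fi; elim: s => [|i s IH].
  by under eq_Rintegral do rewrite big_nil; rewrite Rintegral_cst// mul0r big_nil.
under eq_Rintegral do rewrite big_cons; rewrite big_cons RintegralD// ?IH//.
rewrite (_ : _ \o _ = fun x => (\sum_(j <- s) (f j x)%:E)%E).
  by apply: integrable_sum => // j _; exact: fi.
by apply/funext => x; rewrite /= sumEFin.
Qed.

End BoundedExpectation.

Lemma Rintegral_prod d1 d2 (T1 : measurableType d1) (T2 : measurableType d2)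
    (R : realType) (P1 : probability T1 R) (P2 : probability T2 R)
    (f : T1 -> R) (g : T2 -> R) (c : R) :
  measurable_fun setT f -> measurable_fun setT g ->
  (forall x, `|f x| <= c) -> (forall y, `|g y| <= c) ->
  (P1 \x P2)%E.-integrable setT (EFin \o (fun z : T1 * T2 => f z.1 * g z.2)) /\
  Rintegral (P1 \x P2)%E setT (fun z => f z.1 * g z.2) =
  Rintegral P1 setT f * Rintegral P2 setT g.
Proof.
move=> mf mg fc gc.
have fi := bounded_integrable P1 mf fc; have gi := bounded_integrable P2 mg gc.
have fgi : (P1 \x P2)%E.-integrable setT (EFin \o (fun z : T1 * T2 => f z.1 * g z.2)).
  apply: (@bounded_integrable _ _ _ _ _ (c * c)).
    by apply: measurable_funM; apply: measurableT_comp.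
  by move=> z; rewrite normrM ler_pM.
split => //; rewrite /Rintegral -integral12_prod_meas1//=.
under eq_integral => x _.
  rewrite /fubini_F/=; under eq_integral do rewrite EFinM.
  rewrite integralZl//; over.
rewrite /= -fineM ?integrable_fin_num//; congr fine.
have /fineK <- := integrable_fin_num measurableT gi.
rewrite -[RHS]muleC -integralZl//; apply: eq_integral => x _.
by rewrite muleC.
Qed.

Section Bilinear.
Variables (R : realType) (l : nat).
Local Notation K := (tubal R l.+1).

Definition tdelta m n (e : 'I_l.+1 * 'I_m * 'I_n) : K m n :=
  [ffun k => if k == e.1.1 then delta_mx e.1.2 e.2 else 0].

Lemma tubal_sum_delta m n (X : K m n) :
  X = \sum_e X e.1.1 e.1.2 e.2 *: tdelta e.
Proof.
apply/ffunP => k; apply/matrixP => i j; rewrite sum_ffunE summxE.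
rewrite (bigD1 (k, i, j))//= big1 ?addr0 => [|[[k' i'] j'] ne].
  by rewrite !(ffunE, mxE)/= eqxx mxE !eqxx mulr1.
rewrite !(ffunE, mxE) /=; have [kk'|] := eqVneq k k'; last by rewrite mxE mulr0.
rewrite mxE; have [ii'|] := eqVneq i i'; last by rewrite mulr0.
have [jj'|] := eqVneq j j'; last by rewrite mulr0.
by rewrite kk' ii' jj' eqxx in ne.
Qed.

Lemma scalar_sum m n (f : K m n -> R) I (s : seq I) (c : I -> R) (e : I -> K m n) :
  (forall a X Y, f (a *: X + Y) = a * f X + f Y) ->
  f (\sum_(i <- s) c i *: e i) = \sum_(i <- s) c i * f (e i).
Proof.
move=> flin; elim: s => [|i s IH]; last by rewrite !big_cons flin IH.
by rewrite !big_nil; have := flin (-1) 0 0; rewrite scaler0 addr0 mulN1r addNr.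
Qed.

Variables (m n p q : nat) (Phi : K m n -> K p q -> R).
Hypothesis Phil : forall a Z Z' W, Phi (a *: Z + Z') W = a * Phi Z W + Phi Z' W.
Hypothesis Phir : forall a Z W W', Phi Z (a *: W + W') = a * Phi Z W + Phi Z W'.

Lemma bilinear_sum Z W : Phi Z W = \sum_e \sum_e'
  Phi (tdelta e) (tdelta e') * (Z e.1.1 e.1.2 e.2 * W e'.1.1 e'.1.2 e'.2).
Proof.
rewrite {1}(tubal_sum_delta Z) (scalar_sum (f := Phi^~ W)) => [|a X Y]; last first.
  exact: Phil.
apply: eq_bigr => e _.
rewrite {1}(tubal_sum_delta W) (scalar_sum (f := Phi _)) => [|a X Y]; last first.
  exact: Phir.
rewrite mulr_sumr; apply: eq_bigr => e' _; ring.
Qed.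

Context d1 d2 (T1 : measurableType d1) (T2 : measurableType d2).
Variables (P1 : probability T1 R) (P2 : probability T2 R).
Variables (Z : T1 -> K m n) (W : T2 -> K p q).
Hypotheses (mZ : t_measurable Z) (mW : t_measurable W).
Hypothesis Z1 : forall w k i j, `|Z w k i j| <= 1.
Hypothesis W1 : forall w k i j, `|W w k i j| <= 1.

Lemma texpectE d (T : measurableType d) (P : probability T R) m' n'
    (F : T -> K m' n') k i j :
  texpect P F k i j = Rintegral P setT (fun w => F w k i j).
Proof. by rewrite ffunE mxE unlock. Qed.

(** In the elementary basis [Phi (Z, W)] is a finite combination of products of an entry of Z and an
    entry of W, and each product factors under the product law. *)
Lemma expect_bilinear :
  (P1 \x P2)%E.-integrable setT (EFin \o (fun z => Phi (Z z.1) (W z.2))) /\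
  Rintegral (P1 \x P2)%E setT (fun z => Phi (Z z.1) (W z.2)) =
  Phi (texpect P1 Z) (texpect P2 W).
Proof.
pose F e e' (z : T1 * T2) := Phi (tdelta e) (tdelta e') *
  (Z z.1 e.1.1 e.1.2 e.2 * W z.2 e'.1.1 e'.1.2 e'.2).
have prodF e e' := Rintegral_prod P1 P2 (mZ e.1.1 e.1.2 e.2)
  (mW e'.1.1 e'.1.2 e'.2) (fun w => Z1 w e.1.1 e.1.2 e.2)
  (fun w => W1 w e'.1.1 e'.1.2 e'.2).
have Fi e e' : (P1 \x P2)%E.-integrable setT (EFin \o F e e').
  have [prodI _] := prodF e e'.
  have := integrableZl measurableT (Phi (tdelta e) (tdelta e')) prodI.
  by congr (integrable _ _ _); apply/funext => z; rewrite /= -EFinM.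
have FFi e : (P1 \x P2)%E.-integrable setT
    (EFin \o (fun z => \sum_e' F e e' z)).
  rewrite (_ : _ \o _ = fun z => (\sum_e' (F e e' z)%:E)%E).
    by apply: integrable_sum => // e' _; exact: Fi.
  by apply/funext => x; rewrite /= sumEFin.
have PhiE : (fun z => Phi (Z z.1) (W z.2)) = (fun z => \sum_e \sum_e' F e e' z).
  by apply/funext => z; rewrite bilinear_sum.
rewrite PhiE; split.
  rewrite (_ : _ \o _ = fun z => (\sum_e (\sum_e' F e e' z)%:E)%E).
    by apply: integrable_sum => // e _; exact: FFi.
  by apply/funext => x; rewrite /= sumEFin.
rewrite Rintegral_sum// bilinear_sum; apply: eq_bigr => e _.
rewrite Rintegral_sum//; apply: eq_bigr => e' _.
rewrite !texpectE; have [pi pE] := prodF e e'.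
by rewrite RintegralZl// pE.
Qed.

End Bilinear.

(** The indices do not depend on [A] and [B]: each entry is one fixed bilinear form, to which
    [expect_bilinear] applies. *)
Lemma bcirc_tkron_entry (R : realType) l m n p q a b :
  exists k i j i' j', forall (A : tubal R l.+1 m n) (B : tubal R l.+1 p q),
  bcirc (tkron A B) a b = \sum_u A (k - u) i j * B u i' j'.
Proof.
do 5 eexists; move=> A B; rewrite mxE [tkron _ _ _]ffunE mxE tube_prodE.
by under eq_bigr do rewrite ffunE mxE eqxx mulr1n.
Qed.

Section ExpectedStep.
Variables (R : realType) (l m n r s tau zeta : nat).
Local Notation K := (tubal R l.+1).
Variables (A : K m r) (B : K s n) (M : K r r) (N : K s s).
Hypotheses (hM : tsym_posdef M) (hN : tsym_posdef N).
Variables (DS : probability (K m tau) R) (DV : probability (K n zeta) R).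
Let Z S := sketchZ A M (S : K m tau).
Let W V := sketchW B N (V : K n zeta).
Let EZ := texpect DS Z.
Let EW := texpect DV W.

Lemma t_measurable_sketchW : t_measurable W.
Proof.
rewrite /W; under eq_fun do rewrite sketchW_Z.
exact: t_measurable_sketchZ.
Qed.

Lemma sketchZ_bound S k i j : `|Z S k i j| <= 1.
Proof. by have [? ?] := sketchZ_proj A hM S; exact: proj_bound. Qed.

Lemma sketchW_proj V : ttr (W V) = W V /\ W V ** W V = W V.
Proof. by rewrite /W sketchW_Z; exact: sketchZ_proj. Qed.

Lemma sketchW_bound V k i j : `|W V k i j| <= 1.
Proof. by have [? ?] := sketchW_proj V; exact: proj_bound. Qed.

Let bilinear (Phi : K r r -> K s s -> R)
    (Phil : forall a Z Z' W, Phi (a *: Z + Z') W = a * Phi Z W + Phi Z' W)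
    (Phir : forall a Z W W', Phi Z (a *: W + W') = a * Phi Z W + Phi Z W') :
  (DS \x DV)%E.-integrable setT (EFin \o (fun z => Phi (Z z.1) (W z.2))) /\
  Rintegral (DS \x DV)%E setT (fun z => Phi (Z z.1) (W z.2)) = Phi EZ EW.
Proof.
apply: expect_bilinear => //.
- exact: t_measurable_sketchZ.
- exact: t_measurable_sketchW.
- exact: sketchZ_bound.
- exact: sketchW_bound.
Qed.

Lemma expect_kron :
  mxexpect (DS \x DV)%E (fun SV => bcirc (tkron (W SV.2) (Z SV.1))) =
  bcirc (tkron EW EZ).
Proof.
apply/matrixP => a b; rewrite mxE unlock.
have [k [i [j [i' [j' kronE]]]]] := @bcirc_tkron_entry R l s s r r a b.
have [] // := @bilinear (fun Z W => bcirc (tkron W Z) a b).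
- move=> c Z1 Z2 W1; rewrite !kronE mulr_sumr -big_split/=.
  by apply: eq_bigr => u _; rewrite !(ffunE, mxE); ring.
- move=> c Z1 W1 W2; rewrite !kronE mulr_sumr -big_split/=.
  by apply: eq_bigr => u _; rewrite !(ffunE, mxE); ring.
Qed.

Lemma tdot_linr a (X Y Y' : K r s) : tdot X (a *: Y + Y') = a * tdot X Y + tdot X Y'.
Proof. by rewrite tdotC tdotDl tdotZl !(tdotC _ X). Qed.

Lemma expect_step (X : K r s) :
  (\int[(DS \x DV)%E]_z
     (tdot (X - Z z.1 ** X ** W z.2) (X - Z z.1 ** X ** W z.2))%:E)%E =
  (tdot X X - tdot X (EZ ** X ** EW))%:E.
Proof.
have [||PhiI PhiE] := @bilinear (fun Z W => tdot X (Z ** X ** W)).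
- by move=> c Z1 Z2 W1; rewrite !tprodDl !tprodZl tdot_linr.
- by move=> c Z1 W1 W2; rewrite !tprodDr !tprodZr tdot_linr.
transitivity (\int[(DS \x DV)%E]_z ((cst (tdot X X) z)%:E -
    (tdot X (Z z.1 ** X ** W z.2))%:E))%E.
  apply: eq_integral => z _; have [? ?] := sketchZ_proj A hM z.1.
  by have [? ?] := sketchW_proj z.2; rewrite tdot_step.
rewrite integralB_EFin//; last first.
  by apply: (@bounded_integrable _ _ _ _ _ `|tdot X X|).
rewrite EFinB -PhiE fineK; last exact: integrable_fin_num.
congr (_ - _)%E.
have := @integral_cst _ _ _ (DS \x DV)%E setT measurableT (tdot X X)%:E.
move=> /= ->; rewrite -[RHS]mule1; congr (_ * _)%E.
exact: (@probability_setT _ _ _ (DS \x DV)%E).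
Qed.

Hypothesis hZ : tsym_posdef EZ.
Hypothesis hW : tsym_posdef EW.

Lemma rho_contraction (X : K r s) :
  tdot X X - tdot X (EZ ** X ** EW) <= rho_tesp A B M N DS DV * tdot X X.
Proof.
rewrite /rho_tesp expect_kron mulrBl mul1r lerB//.
exact: lambda_min_tkron.
Qed.

(** On a nonzero [X], rho times the squared norm dominates the mean of a nonnegative quantity. *)
Lemma rho_ge0 : 0 <= rho_tesp A B M N DS DV.
Proof.
have [[X X0]|Xall] := pselect (exists X : K r s, X != 0).
  have : 0 <= rho_tesp A B M N DS DV * tdot X X.
    apply: le_trans (rho_contraction X); rewrite -lee_fin -expect_step.
    by apply: integral_ge0 => z _; rewrite lee_fin tdot_ge0.
  by rewrite pmulr_lge0// tdot_gt0.
(* Without a nonzero [X] there is no eigenvector; the infimum of the empty set is 0 and the rate is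
   1. *)
rewrite /rho_tesp /lambda_min (_ : [set _ | _] = set0) ?inf0 ?subr0//.
apply/seteqP; split => // a /eigenvalueP[v _ v0].
have [X XE] := @tcoord_surj R l r s v.
by apply: Xall; exists X; rewrite -tcoord_eq0 XE.
Qed.

End ExpectedStep.

(** * Independent draws *)

(** Rectangles are stable under intersection and generate the product sigma-algebra. *)
Lemma measure_eq_rectangles d1 d2 (T1 : measurableType d1) (T2 : measurableType d2)
    (R : realType) (m1 m2 : {measure set (T1 * T2) -> \bar R}) :
  (m1 setT < +oo)%E ->
  (forall A B, measurable A -> measurable B -> m1 (A `*` B) = m2 (A `*` B)) ->
  forall X, measurable X -> m1 X = m2 X.
Proof.
move=> m1T m12 X mX; pose G : set (set (T1 * T2)) :=
  [set A `*` B | A in measurable & B in measurable].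
apply: (measure_unique G (fun=> setT)) => //.
- exact: measurable_prod_measurableType.
- move=> _ _ [A mA [B mB <-]] [A' mA' [B' mB' <-]].
  exists (A `&` A'); first exact: measurableI.
  by exists (B `&` B'); [exact: measurableI|rewrite setXI].
- by move=> _; exists setT => //; exists setT; rewrite // setXTT.
- by rewrite bigcup_const.
- by move=> _ [A mA [B mB <-]]; exact: m12.
Qed.

(** By independence the joint law of [U] and [S] is a product; the rest is Tonelli and a change of
    variables. *)
Lemma integral_indep_pair d d' d1 (Omega : measurableType d)
    (T' : measurableType d') (T1 : measurableType d1) (R : realType)
    (P : probability Omega R) (P1 : probability T1 R)
    (U : Omega -> T') (S : Omega -> T1) (g : T' * T1 -> \bar R) :
  measurable_fun setT U -> measurable_fun setT S ->
  (forall A F, measurable A -> measurable F ->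
    P (U @^-1` A `&` S @^-1` F) = P (U @^-1` A) * P1 F)%E ->
  measurable_fun setT g -> (forall x, 0 <= g x)%E ->
  (\int[P]_w g (U w, S w) = \int[P]_w \int[P1]_z g (U w, z))%E.
Proof.
move=> mU mS indep mg g0.
have mUS : measurable_fun setT (fun w => (U w, S w)) by exact: measurable_fun_pair.
pose Um : {mfun Omega >-> T'} := HB.pack U (isMeasurableFun.Build _ _ _ _ U mU).
pose USm : {mfun Omega >-> (T' * T1)%type} :=
  HB.pack (fun w => (U w, S w)) (isMeasurableFun.Build _ _ _ _ _ mUS).
have law X : measurable X ->
    distribution P USm X = (distribution P Um \x P1)%E X.
  apply: measure_eq_rectangles => [|A B mA mB].
    by apply: le_lt_trans (ltry 1); exact: probability_le1.
  transitivity (distribution P Um A * P1 B)%E; first by rewrite -indep.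
  exact/esym/product_measure1E.
transitivity (\int[distribution P USm]_x g x)%E.
  by rewrite ge0_integral_pushforward.
transitivity (\int[(distribution P Um \x P1)]_x g x)%E.
  by apply: eq_measure_integral => X mX _; exact: law.
rewrite fubini_tonelli1// /fubini_F ge0_integral_pushforward//.
- exact: measurable_fun_fubini_tonelli_F.
- by move=> x _; exact: integral_ge0.
Qed.

Lemma integral_indep d d' d1 d2 (Omega : measurableType d)
    (T' : measurableType d') (T1 : measurableType d1) (T2 : measurableType d2)
    (R : realType) (P : probability Omega R) (P1 : probability T1 R)
    (P2 : probability T2 R) (U : Omega -> T') (S : Omega -> T1) (V : Omega -> T2)
    (g : T' * (T1 * T2) -> \bar R) :
  measurable_fun setT U -> measurable_fun setT S -> measurable_fun setT V ->
  (forall A F G, measurable A -> measurable F -> measurable G ->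
    P (U @^-1` A `&` S @^-1` F `&` V @^-1` G) = P (U @^-1` A) * P1 F * P2 G)%E ->
  measurable_fun setT g -> (forall x, 0 <= g x)%E ->
  (\int[P]_w g (U w, (S w, V w)) =
   \int[P]_w \int[(P1 \x P2)%E]_z g (U w, z))%E.
Proof.
move=> mU mS mV indep mg g0.
have mSV : measurable_fun setT (fun w => (S w, V w)) by exact: measurable_fun_pair.
apply: integral_indep_pair => // A B mA mB.
pose SVm : {mfun Omega >-> (T1 * T2)%type} :=
  HB.pack (fun w => (S w, V w)) (isMeasurableFun.Build _ _ _ _ _ mSV).
have mUA : measurable (U @^-1` A) by rewrite -[_ @^-1` _]setTI; exact: mU.
(* For fixed [A], both sides of the product rule are finite measures of [B]: the law of [(S, V)]
   restricted to the event on [U], and the product law scaled by its probability [c]. They agree on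
   rectangles. *)
pose c := NngNum (fine_ge0 (measure_ge0 P (U @^-1` A))).
have cE : c%:num%:E = P (U @^-1` A).
  by rewrite /= fineK// fin_num_measure.
have := @measure_eq_rectangles _ _ _ _ _
  (pushforward (mrestr P mUA) SVm) (mscale c (P1 \x P2)%E).
move=> /(_ mSV) rect; rewrite -cE setIC; apply: rect mB => [|F G mF mG].
  apply: le_lt_trans (ltry 1); apply: probability_le1; apply: measurableI => //.
  exact: measurableT.
transitivity (P (U @^-1` A) * (P1 F * P2 G))%E; last first.
  by rewrite -cE -(product_measure1E P1 P2 mF mG).
rewrite muleA -indep// /pushforward /mrestr; congr (P _).
by rewrite setIC setIA.
Qed.

(** * The TESP iteration *)

Section Past.
Variables (R : realType) (l m n r s tau zeta : nat).
Local Notation K := (tubal R l.+1).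
Variables (A : K m r) (B : K s n) (C : K m n) (M : K r r) (N : K s s).
Hypotheses (hM : tsym_posdef M) (hN : tsym_posdef N).
Variables (DS : probability (K m tau) R) (DV : probability (K n zeta) R).
Variables (Xstar : K r s).
Hypothesis hX : A ** Xstar ** B = C.
Context (d : measure_display) (Omega : measurableType d) (P : probability Omega R).
Variables (X0 : {mfun Omega >-> K r s}) (S : nat -> {mfun Omega >-> K m tau})
  (V : nat -> {mfun Omega >-> K n zeta}).
Hypothesis hdraws : fresh_draws P DS DV X0 S V.

Definition tesp_err t w := terr M N Xstar
  (tesp A B C M N (X0 w) (fun i => S i w) (fun i => V i w) t).

Lemma tesp_errS t w : tesp_err t.+1 w =
  tesp_err t w - sketchZ A M (S t w) ** tesp_err t w ** sketchW B N (V t w).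
Proof. by rewrite /tesp_err /= terr_step. Qed.

Let gens t := generated_by X0 `|` \bigcup_(i in [set i | (i < t)%N])
  (generated_by (S i) `|` generated_by (V i)).

Lemma t_measurable_terr d' (T : measurableType d') (F : T -> K r s) :
  t_measurable F -> t_measurable (fun w => terr M N Xstar (F w)).
Proof.
move=> mF; apply: t_measurableM; last exact: t_measurable_cst.
apply: t_measurableM; first exact: t_measurable_cst.
by apply: t_measurableD => //; exact: t_measurable_cst.
Qed.

Lemma past_measurable t E : past X0 (fun i => S i) (fun i => V i) t E -> measurable E.
Proof.
move: E; apply: smallest_sub; first exact: sigma_algebra_measurable.
move=> E [[U mU <-]|[i _ [[U mU <-]|[U mU <-]]]]; exact: measurable_funPT.
Qed.

(** The bound [u] is separate from [t] so that the sigma-algebra stays fixed along the induction. *)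
Lemma tesp_err_past t u : (t <= u)%N ->
  @t_measurable _ (g_sigma_algebraType (gens u)) R l.+1 r s (tesp_err t).
Proof.
elim: t => [_|t IH tu].
  apply: t_measurable_terr => k i j _ U mU.
  apply: sub_sigma_algebra; left.
  exists ((fun X : K r s => X k i j) @^-1` U) => //.
  rewrite -[_ @^-1` U]setTI; exact: (@t_measurable_id R l.+1 r s).
have {}IH := IH (ltnW tu); rewrite (funext (tesp_errS t)).
apply: t_measurableD; first exact: IH.
apply: t_measurableN; apply: t_measurableM.
  apply: t_measurableM; last exact: IH.
  apply: (@t_measurable_comp R l.+1 r r _ (g_sigma_algebraType (gens u)) _ _
    (sketchZ A M (tau := tau)) (S t)); last exact: t_measurable_sketchZ.
  move=> _ U mU; apply: sub_sigma_algebra; right; exists t => //.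
  by left; exists U.
apply: (@t_measurable_comp R l.+1 s s _ (g_sigma_algebraType (gens u)) _ _
  (sketchW B N (zeta := zeta)) (V t)); last exact: t_measurable_sketchW.
move=> _ U mU; apply: sub_sigma_algebra; right; exists t => //.
by right; exists U.
Qed.

Lemma tesp_err_measurable t : @t_measurable _ Omega R l.+1 r s (tesp_err t).
Proof.
move=> k i j _ U mU; apply: (@past_measurable t).
exact: (tesp_err_past (leqnn t)).
Qed.

Hypothesis hZ : tsym_posdef (texpect DS (sketchZ A M (tau := tau))).
Hypothesis hW : tsym_posdef (texpect DV (sketchW B N (zeta := zeta))).

Let rho := rho_tesp A B M N DS DV.
Let f t w := tdot (tesp_err t w) (tesp_err t w).

Lemma measurable_sqerr t : measurable_fun setT (f t).
Proof. by apply: measurable_tdot; exact: tesp_err_measurable. Qed.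

(** The conditional contraction given the past, expressed by integrals over past events. *)
Lemma sqerr_step t E : past X0 (fun i => S i) (fun i => V i) t E ->
  (\int[P]_(w in E) (f t.+1 w)%:E <= rho%:E * \int[P]_(w in E) (f t w)%:E)%E.
Proof.
move=> pE; have mE := past_measurable pE.
(* The indicator of [E] is carried along with the error, so that the restriction to [E] becomes part
   of a past-measurable variable. *)
pose U w : (R * K r s)%type := (\1_E w, tesp_err t w).
have mUpast : @measurable_fun _ _ (g_sigma_algebraType (gens t)) _ setT U.
  apply: measurable_fun_pair; first exact: measurable_indic.
  by apply: t_measurable_fun; exact: (tesp_err_past (leqnn t)).
have mU : @measurable_fun _ _ Omega _ setT U.
  apply: measurable_fun_pair; first exact: measurable_indic.
  by apply: t_measurable_fun; exact: tesp_err_measurable.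
pose Y (x : (R * K r s) * (K m tau * K n zeta)) :=
  x.1.2 - sketchZ A M x.2.1 ** x.1.2 ** sketchW B N x.2.2.
(* The absolute value keeps [g] nonnegative on the whole product space; on an indicator it changes
   nothing. *)
pose g (x : (R * K r s) * (K m tau * K n zeta)) := (`|x.1.1| * tdot (Y x) (Y x))%:E.
have mX12 : t_measurable (fun x : (R * K r s) * (K m tau * K n zeta) => x.1.2).
  exact: (t_measurable_comp (measurableT_comp measurable_snd measurable_fst)
    (@t_measurable_id R l.+1 r s)).
have mY : t_measurable Y.
  apply: t_measurableD => //; apply: t_measurableN; apply: t_measurableM.
    apply: t_measurableM => //.
    exact: (t_measurable_comp (measurableT_comp measurable_fst measurable_snd)
      (t_measurable_sketchZ A hM)).
  exact: (t_measurable_comp (measurableT_comp measurable_snd measurable_snd)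
    (t_measurable_sketchW B hN)).
have inner a X : (\int[(DS \x DV)%E]_z (`|a| *
      tdot (X - sketchZ A M z.1 ** X ** sketchW B N z.2)
        (X - sketchZ A M z.1 ** X ** sketchW B N z.2))%:E =
    (`|a| * (tdot X X - tdot X (texpect DS (sketchZ A M (tau := tau)) ** X **
      texpect DV (sketchW B N (zeta := zeta)))))%:E)%E.
  rewrite EFinM -(expect_step A B hM hN).
  under eq_integral => z _ do rewrite EFinM.
  have mstep : t_measurable (fun z : K m tau * K n zeta =>
      X - sketchZ A M z.1 ** X ** sketchW B N z.2).
    apply: t_measurableD; first exact: t_measurable_cst.
    apply: t_measurableN; apply: t_measurableM.
      apply: t_measurableM; last exact: t_measurable_cst.
      exact: (t_measurable_comp measurable_fst (t_measurable_sketchZ A hM)).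
    exact: (t_measurable_comp measurable_snd (t_measurable_sketchW B hN)).
  rewrite ge0_integralZl_EFin//.
    by move=> z _; rewrite lee_fin tdot_ge0.
  by apply/measurable_EFinP; exact: measurable_tdot.
have mg : measurable_fun setT g.
  apply/measurable_EFinP; apply: measurable_funM.
    by apply: measurableT_comp => //; apply: measurableT_comp.
  exact: measurable_tdot.
have g0 x : (0 <= g x)%E by rewrite lee_fin mulr_ge0 ?tdot_ge0.
have indep A' F G : measurable A' -> measurable F -> measurable G ->
    P (U @^-1` A' `&` S t @^-1` F `&` V t @^-1` G) = (P (U @^-1` A') * DS F * DV G)%E.
  move=> mA' mF mG; have [lS lV ->] := hdraws t.
  - by rewrite -lS// -lV.
  - by rewrite -[U @^-1` _]setTI; exact: mUpast.
  - by exists F => //; rewrite setTI.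
  - by exists G => //; rewrite setTI.
have intE h : (forall w, 0 <= h w) ->
    (\int[P]_(w in E) (h w)%:E = \int[P]_w (`|\1_E w| * h w)%:E)%E.
  move=> h0; rewrite integral_mkcond; apply: eq_integral => w _.
  rewrite patchE indicE; case: ifPn => wE; first by rewrite normr1 mul1r.
  by rewrite normr0 mul0r.
have mfE : measurable_fun setT (fun w => (`|\1_E w| * f t w)%:E).
  apply/measurable_EFinP; apply: measurable_funM; last exact: measurable_sqerr.
  by apply: measurableT_comp => //; exact: measurable_indic.
pose c X := tdot X X - tdot X (texpect DS (sketchZ A M (tau := tau)) ** X **
  texpect DV (sketchW B N (zeta := zeta))).
have mc : measurable_fun setT (fun w => (`|\1_E w| * c (tesp_err t w))%:E).
  apply/measurable_EFinP; apply: measurable_funM.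
    by apply: measurableT_comp => //; exact: measurable_indic.
  apply: measurable_funB; first exact: measurable_sqerr.
  apply: measurable_tdot; first exact: tesp_err_measurable.
  apply: t_measurableM; last exact: t_measurable_cst.
  by apply: t_measurableM; [exact: t_measurable_cst|exact: tesp_err_measurable].
have stepE : (\int[P]_(w in E) (f t.+1 w)%:E =
    \int[P]_w (`|\1_E w| * c (tesp_err t w))%:E)%E.
  transitivity (\int[P]_w g (U w, (S t w, V t w)))%E.
    rewrite intE => [|w]; last exact: tdot_ge0.
    by apply: eq_integral => w _; rewrite /g /Y /U/= /f tesp_errS.
  rewrite (integral_indep mU _ _ indep mg g0)//.
  by apply: eq_integral => w _; exact: inner.
have fE : (\int[P]_(w in E) (f t w)%:E = \int[P]_w (`|\1_E w| * f t w)%:E)%E.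
  by apply: intE => w; exact: tdot_ge0.
suff : (\int[P]_w (`|\1_E w| * c (tesp_err t w))%:E <=
    rho%:E * \int[P]_w (`|\1_E w| * f t w)%:E)%E.
  by congr (_ <= _)%E; [exact/esym/stepE|congr (_ * _)%E; exact/esym/fE].
have c0 X : 0 <= c X.
  rewrite -lee_fin -(expect_step A B hM hN); apply: integral_ge0 => z _.
  by rewrite lee_fin tdot_ge0.
rewrite -ge0_integralZl_EFin//; first last.
- exact: rho_ge0.
- by move=> w _; rewrite lee_fin mulr_ge0 ?tdot_ge0.
apply: ge0_le_integral => //.
- by move=> w _; rewrite lee_fin mulr_ge0.
- exact: measurable_funeM.
- move=> w _; rewrite -EFinM lee_fin mulrCA ler_wpM2l//.
  exact: rho_contraction.
Qed.

Lemma sqerr_le t E : generated_by X0 E ->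
  (\int[P]_(w in E) (f t w)%:E <= (rho ^+ t)%:E * \int[P]_(w in E) (f 0 w)%:E)%E.
Proof.
move=> gE; elim: t => [|t IH]; first by rewrite mul1e.
have pE : past X0 (fun i => S i) (fun i => V i) t E.
  by apply: sub_sigma_algebra; left.
apply: le_trans (sqerr_step pE) _; rewrite exprS EFinM -muleA.
by apply: lee_wpmul2l => //; rewrite lee_fin rho_ge0.
Qed.

Lemma sqerr_cond t (Y : Omega -> \bar R) :
  is_cond_expectation P (generated_by X0) (fun w => (f t w)%:E) Y ->
  {ae P, forall w, (Y w <= (rho ^+ t * f 0 w)%:E)%E}.
Proof.
move=> [mY Y0 intY].
pose h w : \bar R := (rho ^+ t * f 0 w)%:E.
have mX0 E : generated_by X0 E -> measurable E.
  by move=> [U mU <-]; exact: measurable_funPT.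
have mYX : @measurable_fun _ _ (g_sigma_algebra_preimageType X0) _ setT Y.
  by move=> _ U mU; rewrite setTI; exact: mY.
have mf0X : @measurable_fun _ _ (g_sigma_algebra_preimageType X0) _ setT (f 0).
  have mxi : @t_measurable _ (g_sigma_algebra_preimageType X0) R l.+1 r s (tesp_err 0).
    apply: t_measurable_terr => k i j _ U mU.
    exists ((fun X : K r s => X k i j) @^-1` U) => //.
    rewrite -[_ @^-1` U]setTI; exact: (@t_measurable_id R l.+1 r s).
  exact: measurable_tdot.
have mhX : @measurable_fun _ _ (g_sigma_algebra_preimageType X0) _ setT h.
  by apply/measurable_EFinP; exact: measurable_funM.
have mYO : @measurable_fun _ _ Omega _ setT Y.
  by move=> _ U mU; apply: mX0; rewrite setTI; exact: mY.
have mhO : @measurable_fun _ _ Omega _ setT h.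
  by move=> mT U mU; apply: mX0; exact: mhX.
have h0 w : (0 <= h w)%E.
  by rewrite lee_fin mulr_ge0 ?exprn_ge0 ?rho_ge0 ?tdot_ge0.
(* On [D q] the bound [h] is at most [rho ^+ t * q], so its integral is finite and can be cancelled;
   the excess [Y - h], positive there, then has integral 0. *)
pose D q := [set w | (h w < Y w)%E] `&` [set w | ((f 0 w)%:E <= q%:R%:E)%E].
have gD q : generated_by X0 (D q).
  have mD : @measurable _ (g_sigma_algebra_preimageType X0) (D q).
    apply: measurableI.
      by rewrite -[X in measurable X]setTI; exact: measurable_lte.
    rewrite -[X in measurable X]setTI; apply: measurable_lee => //.
    exact/measurable_EFinP.
  exact: mD.
have D0 q : P.-negligible (D q).
  have mD := mX0 _ (gD q).
  pose k w := (Y w - h w)%E.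
  have k0 w : D q w -> (0 <= k w)%E by move=> [/ltW hY _]; rewrite sube_ge0.
  have mk : measurable_fun (D q) k.
    by apply: measurable_funTS; exact: emeasurable_funB.
  have intD : (\int[P]_(w in D q) Y w =
      \int[P]_(w in D q) h w + \int[P]_(w in D q) k w)%E.
    rewrite -ge0_integralD//; last exact: measurable_funTS.
    by apply: eq_integral => w _; rewrite /k addeC subeK.
  have inth : (\int[P]_(w in D q) h w =
      (rho ^+ t)%:E * \int[P]_(w in D q) (f 0 w)%:E)%E.
    rewrite -ge0_integralZl_EFin ?exprn_ge0 ?rho_ge0//.
    - by move=> w _; rewrite lee_fin tdot_ge0.
    - by apply/measurable_EFinP; apply: measurable_funTS; exact: measurable_sqerr.
  have hfin : (\int[P]_(w in D q) h w \is a fin_num)%E.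
    rewrite ge0_fin_numE; last by apply: integral_ge0 => w _.
    apply: (@le_lt_trans _ _ (\int[P]_(w in D q) (cst (rho ^+ t * q%:R)%:E) w)%E).
      apply: ge0_le_integral => //.
      - exact: measurable_funTS.
      - move=> w [_ /= fq]; rewrite lee_fin; apply: ler_wpM2l => //.
        by rewrite exprn_ge0 ?rho_ge0.
    rewrite integral_cst//; apply: le_lt_trans (ltry (rho ^+ t * q%:R)).
    rewrite -[leRHS]mule1; apply: lee_wpmul2l; last exact: probability_le1.
    by rewrite lee_fin mulr_ge0 ?exprn_ge0 ?rho_ge0.
  have intk : (\int[P]_(w in D q) `|k w| = 0)%E.
    apply/eqP; rewrite eq_le integral_ge0// andbT.
    under eq_integral => w /set_mem wD do rewrite gee0_abs ?k0//.
    have : (\int[P]_(w in D q) h w + \int[P]_(w in D q) k w <=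
        \int[P]_(w in D q) h w + 0)%E.
      rewrite adde0; have := sqerr_le t (gD q).
      by congr (_ <= _)%E; [rewrite -intD; exact/esym/intY|exact/esym/inth].
    by rewrite leeD2lE.
  move/(ae_eq_integral_abs P mD mk): intk => aek.
  apply: negligibleS aek => w wD /(_ wD) kw; have [/= hY _] := wD.
  by move: hY; rewrite -sube_gt0 -/(k w) kw ltxx.
apply: (@negligibleS _ _ _ _ (\bigcup_q D q)); last exact: negligible_bigcup.
move=> w /= /negP; rewrite -ltNge => hY.
(* The initial error is finite at each [w], so every violation lies in some [D q]. *)
exists (Num.truncn (f 0 w)).+1 => //; split => //=.
by rewrite lee_fin ltW// truncnS_gt.
Qed.

End Past.

Theorem theorem2 (R : realType) (l m n r s tau zeta : nat)
  (A : tubal R l.+1 m r) (B : tubal R l.+1 s n) (C : tubal R l.+1 m n)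
  (M : tubal R l.+1 r r) (N : tubal R l.+1 s s)
  (hM : tsym_posdef M) (hN : tsym_posdef N)
  (DS : probability (tubal R l.+1 m tau) R)
  (DV : probability (tubal R l.+1 n zeta) R)
  (hZ : tsym_posdef (texpect DS (sketchZ A M (tau := tau))))
  (hW : tsym_posdef (texpect DV (sketchW B N (zeta := zeta))))
  (Xstar : tubal R l.+1 r s) (hXstar : A ** Xstar ** B = C)
  (d : measure_display) (Omega : measurableType d) (P : probability Omega R)
  (X0 : {mfun Omega >-> tubal R l.+1 r s})
  (S : nat -> {mfun Omega >-> tubal R l.+1 m tau})
  (V : nat -> {mfun Omega >-> tubal R l.+1 n zeta})
  (hdraws : fresh_draws P DS DV X0 S V)
  (t : nat) (Y : Omega -> \bar R)
  (hY : is_cond_expectation P (generated_by X0)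
     (fun w => (wnorm_sq M N
        (tesp A B C M N (X0 w) (fun i => S i w) (fun i => V i w) t
           - Xstar))%:E) Y) :
  {ae P, forall w,
     (Y w <= (rho_tesp A B M N DS DV ^+ t * wnorm_sq M N (X0 w - Xstar))%:E)%E}.

Proof.
have fE : (fun w => (wnorm_sq M N (tesp A B C M N (X0 w) (fun i => S i w)
      (fun i => V i w) t - Xstar))%:E) =
    (fun w => (tdot (tesp_err A B C M N Xstar X0 S V t w)
      (tesp_err A B C M N Xstar X0 S V t w))%:E).
  by apply/funext => w; rewrite wnorm_terr.
rewrite {}fE in hY; apply: filterS (sqerr_cond hM hN hXstar hdraws hZ hW hY) => w.
by rewrite wnorm_terr.
Qed.
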